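(* Consider the decision problem whose input consists of a positive integer $N$ together with a finite system $\Sigma$ of constraints over a finite set of variables, each constraint having one of the forms \[ x + k \leq_N y + \ell,\quad x \leq_N k,\quad x \geq_N k,\quad x + k <_N y + \ell,\quad x <_N k,\quad x >_N k,\quad x + k =_N y + \ell,\quad x =_N k, \] where $x,y$ are variables and $k,\ell$ are integer constants (all integers encoded in binary), and which asks whether there is an assignment of residues in $\{0,1,\dots,N-1\}$ to the variables satisfying all constraints of $\Sigma$. This problem belongs to NP.
   Context: For a positive integer $N$, every integer $i$ is congruent modulo $N$ to a unique residue $i_N \in \{0,1,\dots,N-1\}$. For integers $i,j$ define $i \leq_N j$ iff $i_N \leq j_N$, $i <_N j$ iff $i_N < j_N$, $i \geq_N j$ iff $i_N \geq j_N$, $i >_N j$ iff $i_N > j_N$, and $i =_N j$ iff $i_N = j_N$, where the residues are compared with the usual integer order on $\{0,\dots,N-1\}$. A constraint is satisfied by an assignment if the relation holds for the assigned values. *)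

(* Defs.v *)
From Stdlib Require Import ZArith.
From HB Require Import structures.
From mathcomp Require Import all_boot.

Set Implicit Arguments.
Unset Strict Implicit.
Unset Printing Implicit Defensive.

(** * Deterministic multi-tape Turing machines *)

Variant move := MoveL | MoveR | Stay.

(** A machine has [tm_extra.+1] two-way infinite tapes. A cell holds the blank
    [None], an input symbol [Some (inl a)] or an auxiliary symbol
    [Some (inr g)]. [tm_verdict q] is [Some true] on accepting states,
    [Some false] on rejecting states and [None] on non-halting states. *)
Record TM (A : finType) := MkTM {
  tm_extra : nat;
  tm_aux : finType;
  tm_state : finType;
  tm_start : tm_state;
  tm_verdict : tm_state -> option bool;
  tm_trans : tm_state -> {ffun 'I_tm_extra.+1 -> option (A + tm_aux)} ->
             tm_state * ('I_tm_extra.+1 -> option (A + tm_aux) * move)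
}.

Definition tm_cell (A : finType) (M : TM A) : Type := option (A + tm_aux M).

(** The cells left of the head are listed from the head outwards, and
    everything beyond the two lists is blank. *)
Record tape (C : Type) := MkTape { t_left : seq C; t_cur : C; t_right : seq C }.

Definition tape_move (C : Type) (blank : C) (t : tape C) (m : move) : tape C :=
  let: MkTape l c r := t in
  match m with
  | Stay => t
  | MoveL => if l is a :: l' then MkTape l' a (c :: r)
             else MkTape [::] blank (c :: r)
  | MoveR => if r is a :: r' then MkTape (c :: l) a r'
             else MkTape (c :: l) blank [::]
  end.

Definition tape_write (C : Type) (t : tape C) (c : C) : tape C :=
  MkTape (t_left t) c (t_right t).

Definition tape_of_seq (C : Type) (blank : C) (s : seq C) : tape C :=
  if s is a :: s' then MkTape [::] a s' else MkTape [::] blank [::].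

Record config (A : finType) (M : TM A) := MkConfig {
  c_state : tm_state M;
  c_tapes : 'I_(tm_extra M).+1 -> tape (tm_cell M)
}.

Definition tm_init (A : finType) (M : TM A) (x : seq A) : config M :=
  MkConfig (tm_start M)
    (fun i => tape_of_seq None
       (if i == ord0 then [seq Some (inl a) | a <- x] else [::])).

Definition tm_step (A : finType) (M : TM A) (c : config M) : config M :=
  if tm_verdict (c_state c) is Some _ then c else
  let: (q, act) := tm_trans (c_state c) [ffun i => t_cur (c_tapes c i)] in
  MkConfig q (fun i =>
    tape_move None (tape_write (c_tapes c i) (act i).1) (act i).2).

Definition tm_run (A : finType) (M : TM A) (x : seq A) (n : nat) : config M :=
  iter n (@tm_step A M) (tm_init M x).

(** * The classes P and NP *)

Definition in_P (A : finType) (L : seq A -> Prop) : Prop :=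
  exists (M : TM A) (c d : nat), forall x : seq A, exists b : bool,
    tm_verdict (c_state (tm_run M x (c * size x ^ d + c))) = Some b /\
    (L x <-> b = true).

(** The pair of an input [x] and a certificate [w] is the word [x w] over the
    disjoint union of their alphabets. *)
Definition pair_word (A B : Type) (x : seq A) (w : seq B) : seq (A + B) :=
  [seq inl a | a <- x] ++ [seq inr b | b <- w].

Definition in_NP (A : finType) (L : seq A -> Prop) : Prop :=
  exists (B : finType) (V : seq (A + B)%type -> Prop) (c d : nat),
    in_P V /\
    forall x : seq A,
      L x <-> exists w : seq B, size w <= c * size x ^ d + c /\
                                V (pair_word x w).

(** A decision problem on instances of type [X], as a language. *)
Definition problem_language (X A : Type) (encode : X -> seq A)
    (yes : X -> Prop) (s : seq A) : Prop :=
  exists I : X, s = encode I /\ yes I.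

(** * Modular order constraints *)

Definition residue (N : positive) (i : Z) : Z := (i mod Z.pos N)%Z.

Definition leN (N : positive) (i j : Z) : Prop := (residue N i <= residue N j)%Z.
Definition ltN (N : positive) (i j : Z) : Prop := (residue N i < residue N j)%Z.
Definition geN (N : positive) (i j : Z) : Prop := (residue N i >= residue N j)%Z.
Definition gtN (N : positive) (i j : Z) : Prop := (residue N i > residue N j)%Z.
Definition eqN (N : positive) (i j : Z) : Prop := residue N i = residue N j.

Definition var := positive.

Inductive constraint :=
| VarLeVar (x : var) (k : Z) (y : var) (l : Z)
| VarLeCst (x : var) (k : Z)
| VarGeCst (x : var) (k : Z)
| VarLtVar (x : var) (k : Z) (y : var) (l : Z)
| VarLtCst (x : var) (k : Z)
| VarGtCst (x : var) (k : Z)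
| VarEqVar (x : var) (k : Z) (y : var) (l : Z)
| VarEqCst (x : var) (k : Z).

Definition satisfies (N : positive) (a : var -> Z) (c : constraint) : Prop :=
  match c with
  | VarLeVar x k y l => leN N (a x + k) (a y + l)
  | VarLeCst x k => leN N (a x) k
  | VarGeCst x k => geN N (a x) k
  | VarLtVar x k y l => ltN N (a x + k) (a y + l)
  | VarLtCst x k => ltN N (a x) k
  | VarGtCst x k => gtN N (a x) k
  | VarEqVar x k y l => eqN N (a x + k) (a y + l)
  | VarEqCst x k => eqN N (a x) k
  end.

(** The finite set of variables of an instance is the set of variables
    occurring in its constraints; an assignment gives residues to all variable
    names, and its values at the other names are irrelevant. *)
Record instance := MkInstance {
  modulus : positive;
  constraints : seq constraint
}.

Definition satisfiable (I : instance) : Prop :=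
  exists a : var -> Z,
    (forall x : var, (0 <= a x < Z.pos (modulus I))%Z) /\
    List.Forall (satisfies (modulus I) a) (constraints I).

(** * Binary encoding of instances *)

Inductive symbol :=
  Bit0 | Bit1 | Plus | Minus | SVar | SLe | SGe | SLt | SGt | SEq | Sep.

Definition symbols : seq symbol :=
  [:: Bit0; Bit1; Plus; Minus; SVar; SLe; SGe; SLt; SGt; SEq; Sep].

Definition symbol_code (s : symbol) : 'I_11 :=
  match s with
  | Bit0 => @Ordinal 11 0 isT
  | Bit1 => @Ordinal 11 1 isT
  | Plus => @Ordinal 11 2 isT
  | Minus => @Ordinal 11 3 isT
  | SVar => @Ordinal 11 4 isT
  | SLe => @Ordinal 11 5 isT
  | SGe => @Ordinal 11 6 isT
  | SLt => @Ordinal 11 7 isT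
  | SGt => @Ordinal 11 8 isT
  | SEq => @Ordinal 11 9 isT
  | Sep => @Ordinal 11 10 isT
  end.

Lemma symbol_codeK : cancel symbol_code (fun i => nth Bit0 symbols i).
Proof. by case. Qed.

HB.instance Definition _ := Finite.copy symbol (can_type symbol_codeK).

(** Least significant bit first; the last bit is always [Bit1]. *)
Fixpoint encode_pos (p : positive) : seq symbol :=
  match p with
  | xH => [:: Bit1]
  | xO q => Bit0 :: encode_pos q
  | xI q => Bit1 :: encode_pos q
  end.

Definition encode_Z (k : Z) : seq symbol :=
  match k with
  | Z0 => [:: Plus]
  | Zpos p => Plus :: encode_pos p
  | Zneg p => Minus :: encode_pos p
  end.

Definition encode_var (x : var) : seq symbol := SVar :: encode_pos x.

Definition encode_constraint (c : constraint) : seq symbol :=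
  let var_var r x k y l :=
    encode_var x ++ encode_Z k ++ r :: encode_var y ++ encode_Z l in
  let var_cst r x k := encode_var x ++ r :: encode_Z k in
  match c with
  | VarLeVar x k y l => var_var SLe x k y l
  | VarLeCst x k => var_cst SLe x k
  | VarGeCst x k => var_cst SGe x k
  | VarLtVar x k y l => var_var SLt x k y l
  | VarLtCst x k => var_cst SLt x k
  | VarGtCst x k => var_cst SGt x k
  | VarEqVar x k y l => var_var SEq x k y l
  | VarEqCst x k => var_cst SEq x k
  end.

Definition encode_instance (I : instance) : seq symbol :=
  encode_pos (modulus I) ++
  flatten [seq Sep :: encode_constraint c | c <- constraints I].

Definition bit_free_head (s : seq symbol) : bool :=
  match s with Bit0 :: _ | Bit1 :: _ => false | _ => true end.

Lemma encode_pos_cat_inj p q s t :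
  bit_free_head s -> bit_free_head t ->
  encode_pos p ++ s = encode_pos q ++ t -> p = q /\ s = t.
Proof.
move=> hs ht; elim: p q => [p IHp|p IHp|] [q|q|] //=.
- by case=> /IHp [-> ->].
- by case=> E; move: ht; rewrite -E; case: (p).
- by case=> /IHp [-> ->].
- by case=> E; move: hs; rewrite E; case: (q).
- by case.
Qed.

Lemma encode_Z_cat_inj k l s t :
  bit_free_head s -> bit_free_head t ->
  encode_Z k ++ s = encode_Z l ++ t -> k = l /\ s = t.
Proof.
move=> hs ht; case: k l => [|p|p] [|q|q] //=.
- by case.
- by case=> E; move: hs; rewrite E; case: (q).
- by case=> E; move: ht; rewrite -E; case: (p).
- by case=> /(encode_pos_cat_inj hs ht) [-> ->].
- by case=> /(encode_pos_cat_inj hs ht) [-> ->].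
Qed.

Definition sep_head (s : seq symbol) : bool :=
  match s with [::] | Sep :: _ => true | _ => false end.

Lemma encode_constraint_cat_inj c d s t :
  sep_head s -> sep_head t ->
  encode_constraint c ++ s = encode_constraint d ++ t -> c = d /\ s = t.
Proof.
have bitf u : sep_head u -> bit_free_head u by case: u => [|[]].
move=> /bitf hs /bitf ht.
have hZ k u : bit_free_head (encode_Z k ++ u) by case: k.
case: c => [x k y l|x k|x k|x k y l|x k|x k|x k y l|x k];
case: d => [x' k' y' l'|x' k'|x' k'|x' k' y' l'|x' k'|x' k'|x' k' y' l'|x' k'];
rewrite /= -!catA /= => -[] /encode_pos_cat_inj [] // ->;
first [ by case: k | by case: k' | idtac ];
first [ by case=> /encode_Z_cat_inj [] // -> -> | by case; case: k
      | by case; case: k' | idtac ];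
by move=> /encode_Z_cat_inj [] // -> []; rewrite -?catA /=;
   move=> /encode_pos_cat_inj [] // -> /encode_Z_cat_inj [] // -> ->.
Qed.

Lemma encode_instance_inj : injective encode_instance.
Proof.
have sepP cs : sep_head (flatten [seq Sep :: encode_constraint c | c <- cs]).
  by case: cs.
have bitP cs :
    bit_free_head (flatten [seq Sep :: encode_constraint c | c <- cs]).
  by case: cs.
case=> [N cs] [N' ds]; rewrite /encode_instance /=.
move=> /encode_pos_cat_inj [] // -> E; congr MkInstance.
elim: cs ds E => [|c cs IH] [|d ds] //= [].
by move=> /encode_constraint_cat_inj [] // -> /IH ->.
Qed.

(* Main.v *)
From Stdlib Require Import ZArith Lia.
From HB Require Import structures.
From mathcomp Require Import all_boot.
From mathcomp Require Import zify.
Require Import Defs.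

(** A certificate is the run of a row system: a word over a finite alphabet of
    cells (a "row") that is rewritten step by step, each step consuming at most
    one input symbol and relating the old row to the new one by a relation that
    a finite automaton recognises. A real-time Turing machine checks such a run
    when the certificate spells out every row, so a problem decided by row
    systems with polynomially many rows of polynomial length is in NP.

    The row system for modular constraints reads the input backwards, so that
    numerals arrive most significant bit first and are evaluated by Horner's
    rule. A row packs four binary registers (the guessed modulus [N], the
    current constant, the current variable value, the saved right-hand side)
    and a guessed table of entries "$ name : value". Linear (in)equalities
    between registers are finite-state by carry propagation, hence so is
    arithmetic modulo [N]. A variable name is looked up by marking in parallel
    all table positions that match the bits read so far; then the value is
    guessed bit by bit and every marked position must agree with it. This makes
    the value a function of the name, which is the satisfying assignment. *)

Set Implicit Arguments.
Unset Strict Implicit.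
Unset Printing Implicit Defensive.

(** * Real-time verification by a Turing machine *)

Section RealTime.

Variables (A G Q : finType).
Let cell := option (A + G).
Variable q0 : Q.
Variable act : Q -> A -> cell -> cell -> Q * ((cell * move) * (cell * move)).
Variable fin : Q -> cell -> cell -> bool.

Definition tape_act (t : tape cell) (x : cell * move) : tape cell :=
  tape_move None (tape_write t x.1) x.2.

Definition rt_conf : Type := Q * (tape cell * tape cell).

Definition rt_step (w : rt_conf) (a : A) : rt_conf :=
  let: (q, (t1, t2)) := w in
  let: (q', (x1, x2)) := act q a (t_cur t1) (t_cur t2) in
  (q', (tape_act t1 x1, tape_act t2 x2)).

Definition rt_fin (w : rt_conf) : bool :=
  let: (q, (t1, t2)) := w in fin q (t_cur t1) (t_cur t2).

Definition rt_init : rt_conf :=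
  (q0, (MkTape [::] None [::], MkTape [::] None [::])).

Definition rt_accepts (z : seq A) : bool := rt_fin (foldl rt_step rt_init z).

Definition rt_trans (st : Q + bool) (f : {ffun 'I_3 -> cell}) :
    (Q + bool) * ('I_3 -> cell * move) :=
  let i1 := @Ordinal 3 1 isT in let i2 := @Ordinal 3 2 isT in
  if st is inl q then
    if f ord0 is Some (inl a) then
      let: (q', (x1, x2)) := act q a (f i1) (f i2) in
      (inl q', fun i => nth (f i, Stay) [:: (f i, MoveR); x1; x2] i)
    else (inr (fin q (f i1) (f i2)), fun i => (f i, Stay))
  else (st, fun i => (f i, Stay)).

Definition rt_tm : TM A :=
  @MkTM A 2 G (Q + bool)%type (inl q0)
    (fun st => if st is inr b then Some b else None) rt_trans.

(** What the input head has passed is never read again, so [l] is left open; the defaults of [head]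
    and [behead] describe the blank met once [z] is exhausted. *)
Definition rt_sim (c : config rt_tm) (z : seq A) (w : rt_conf) : Prop :=
  let s := [seq Some (inl a) | a <- z] in
  [/\ c_state c = inl w.1,
      exists l, c_tapes c ord0 = MkTape l (head None s) (behead s),
      c_tapes c (@Ordinal 3 1 isT) = w.2.1 &
      c_tapes c (@Ordinal 3 2 isT) = w.2.2].

Lemma rt_tm_run c z w : rt_sim c z w ->
  c_state (iter (size z).+1 (@tm_step _ rt_tm) c)
    = inr (rt_fin (foldl rt_step w z)).
Proof.
elim: z c w => [|a z IH] c [q [t1 t2]] [Eq [l E0] E1 E2].
  by rewrite /= /tm_step Eq /= !ffunE E0 /= E1 E2.
rewrite iterSr; apply: IH; rewrite /= in Eq E0 E1 E2.
rewrite /rt_sim /tm_step Eq /= !ffunE E0 /= E1 E2 /=.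
case: (act _ _ _ _) => q' [x1 x2] /=; split=> //=.
- exists (Some (inl a) :: l); rewrite ffunE E0 /=.
  by case: (z).
- by rewrite E1.
- by rewrite E2.
Qed.

Lemma rt_in_P : in_P (fun z => rt_accepts z).
Proof.
exists rt_tm, 1, 1 => z; exists (rt_accepts z); split=> //.
rewrite mul1n expn1 addn1 /tm_run (@rt_tm_run _ z rt_init) //.
split=> //=; exists [::].
by case: z.
Qed.

End RealTime.

(** * Row systems *)

#[local] Arguments tape_move : simpl never.
#[local] Arguments tape_write : simpl never.

Record dfa (C : Type) := MkDfa {
  dfa_state : finType;
  dfa_start : dfa_state;
  dfa_next : dfa_state -> C -> dfa_state;
  dfa_final : pred dfa_state
}.

Definition dfa_accepts (C : Type) (D : dfa C) (s : seq C) : bool :=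
  dfa_final (foldl (@dfa_next C D) (dfa_start D) s).

Definition regular2 (C : Type) (P : seq C -> seq C -> Prop) : Prop :=
  exists D : dfa (C * C), forall r r', size r = size r' ->
    dfa_accepts D (zip r r') <-> P r r'.

Definition pop (A : Type) (a : option A) (s : seq A) : seq A :=
  if a is Some b then b :: s else s.

(** The index bounds the number of steps from above, because [RunAccept] holds for every [n];
    acceptance requires the input to be used up. *)
Inductive row_run (A C G : Type) (acc : G) (next : G * option A -> G)
    (rule : G * option A -> seq C -> seq C -> Prop) :
    G -> seq A -> seq C -> nat -> Prop :=
| RunAccept r n : row_run acc next rule acc [::] r n
| RunStep g a s r r' n :
    size r = size r' -> rule (g, a) r r' ->
    row_run acc next rule (next (g, a)) s r' n ->
    row_run acc next rule g (pop a s) r n.+1.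

Lemma row_run_le (A C G : Type) (acc : G) (next : G * option A -> G) rule
    g s (r : seq C) m n :
  m <= n -> row_run acc next rule g s r m -> row_run acc next rule g s r n.
Proof.
move=> le_mn run; elim: run n le_mn => {g s r m} [r m|g a s r r' m sz R _ IH] n.
  by move=> _; apply: RunAccept.
by case: n => // n le_mn; apply: RunStep sz R (IH _ le_mn).
Qed.

Section RowSystem.

Variables (A C G : finType) (g0 acc : G) (next : G * option A -> G).
Variable rule : G * option A -> seq C -> seq C -> Prop.

Let run := row_run acc next rule.

(** * A Turing machine that checks a certified run *)

Section Verifier.

Variable D : G * option A -> dfa (C * C).
Hypothesis DP : forall e r r', size r = size r' ->
  dfa_accepts (D e) (zip r r') <-> rule e r r'.

(** In a certificate [inl a] announces the input symbol, if any, that the next rule consumes,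
    [inr (Some c)] spells a cell of a row, and [inr None] ends a row or fills the time needed for
    rewinding. *)
Let B : finType := (option A + option C)%type.
Let cell : Type := option ((A + B) + option C).
Let stk (a : A) : cell := Some (inl (inl a)).
Let cel (c : C) : cell := Some (inr (Some c)).
(* Marks the left end of the row tape. *)
Let sentinel : cell := Some (inr None).

Let pass : finType := {e : G * option A & dfa_state (D e)}.
Let mode : finType := (option (bool + ((G + G) + pass)))%type.
Let Fail : mode := None.
Let Copy : mode := Some (inl false).
Let Init : mode := Some (inl true).
Let Rewind (g : G) : mode := Some (inr (inl (inl g))).
Let Ready (g : G) : mode := Some (inr (inl (inr g))).
Let Pass (e : G * option A) (q : dfa_state (D e)) : mode :=
  Some (inr (inr (Tagged (fun e => dfa_state (D e)) q))).

Let work : Type := (mode * ((cell * move) * (cell * move)))%type.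

(** The cases are, in order, [Copy], [Init], [Rewind], [Ready] and [Pass]. The input is stacked on
    the first tape and the row lives on the second; a pass overwrites the row from left to right
    while the automaton of the announced rule reads the pairs of old and new cells. *)
Let act (m : mode) (a : A + B) (c1 c2 : cell) : work :=
  let stay1 := (c1, Stay) in
  let stay2 := (c2, Stay) in
  let fail : work := (Fail, (stay1, stay2)) in
  match m, a with
  | Some (inl false), inl a => (Copy, ((stk a, MoveR), stay2))
  | Some (inl false), inr _ => (Init, ((c1, MoveL), (sentinel, MoveR)))
  | Some (inl true), inr (inr (Some c)) => (Init, (stay1, (cel c, MoveR)))
  | Some (inl true), inr (inr None) => (Rewind g0, (stay1, (c2, MoveL)))
  | Some (inr (inl (inl g))), inr _ =>
      if c2 == sentinel then (Ready g, (stay1, (c2, MoveR)))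
      else (Rewind g, (stay1, (c2, MoveL)))
  | Some (inr (inl (inr g))), inr (inl None) =>
      (Pass (dfa_start (D (g, None))), (stay1, stay2))
  | Some (inr (inl (inr g))), inr (inl (Some a)) =>
      if c1 == stk a then
        (Pass (dfa_start (D (g, Some a))), ((c1, MoveL), stay2))
      else fail
  | Some (inr (inr (existT e q))), inr (inr (Some c')) =>
      if c2 is Some (inr (Some c)) then
        (Pass (dfa_next q (c, c')), (stay1, (cel c', MoveR)))
      else fail
  | Some (inr (inr (existT e q))), inr (inr None) =>
      if (c2 == None) && dfa_final q then
        (Rewind (next e), (stay1, (c2, MoveL)))
      else fail
  | _, _ => fail
  end.

Let fin (m : mode) (c1 c2 : cell) : bool :=
  if m is Some (inr (inl (inr g))) then (g == acc) && (c1 == None) else false.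

Let step := rt_step act.
Let final (m : mode) (t1 t2 : tape cell) (w : seq B) : bool :=
  rt_fin fin (foldl step (m, (t1, t2)) [seq inr b | b <- w]).

(** The cells in [j], on the right of the head, are never visited again. *)
Let stack_tape (s : seq A) (j : seq cell) : tape cell :=
  if s is a :: s' then MkTape [seq stk a | a <- s'] (stk a) j
  else MkTape [::] None j.

(* The head is on the first cell of [r], the cells of [l] being on its left. *)
Let row_tape (l r : seq C) : tape cell :=
  let right := rcons [seq cel c | c <- r] None in
  MkTape (rcons [seq cel c | c <- l] sentinel) (head None right)
    (behead right).

Let sentinel_tape (r : seq C) : tape cell :=
  MkTape [::] sentinel (rcons [seq cel c | c <- r] None).

Lemma stack_tape_pop a s j :
  tape_move None (stack_tape (a :: s) j) MoveL
    = stack_tape s (stk a :: j).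
Proof. by case: s. Qed.

Lemma row_tape_left c l r :
  tape_move None (row_tape (c :: l) r) MoveL = row_tape l (c :: r).
Proof. by case: r. Qed.

Lemma row_tape_left0 r :
  tape_move None (row_tape [::] r) MoveL = sentinel_tape r.
Proof. by case: r. Qed.

Lemma sentinel_tape_right r :
  tape_move None (sentinel_tape r) MoveR = row_tape [::] r.
Proof. by case: r. Qed.

Lemma row_tape_write c' l c r :
  tape_move None (tape_write (row_tape l (c :: r)) (cel c')) MoveR
    = row_tape (c' :: l) r.
Proof. by case: r. Qed.

Lemma tape_write_cur (t : tape cell) : tape_write t (t_cur t) = t.
Proof. by case: t. Qed.

Lemma tape_stay (t : tape cell) : tape_move None t Stay = t.
Proof. by case: t. Qed.

Lemma final_cons m t1 t2 b w :
  final m t1 t2 (b :: w) =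
    let: (m', (x1, x2)) := act m (inr b) (t_cur t1) (t_cur t2) in
    final m' (tape_act t1 x1) (tape_act t2 x2) w.
Proof.
rewrite /final /= /rt_step.
by case: (act _ _ _ _) => m' [x1 x2].
Qed.

Lemma final_Fail t1 t2 w : final Fail t1 t2 w = false.
Proof. by elim: w t1 t2 => // b w IH t1 t2; rewrite final_cons /= IH. Qed.

Lemma row_tape_cur l r : t_cur (row_tape l r) != sentinel.
Proof. by case: r. Qed.

(** The modes lead to one another, so they share one induction on the certificate. While rewinding,
    the row is [rev l ++ r]; during a pass, [rev l] is the part of the new row already written and
    [r] the part of the old row still to be overwritten. *)
Lemma final_sound w :
  [/\ forall g s j r, final (Ready g) (stack_tape s j) (row_tape [::] r) w ->
        exists n, run g s r n,
      forall g s j r, final (Rewind g) (stack_tape s j) (sentinel_tape r) w ->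
        exists n, run g s r n,
      forall g s j l r, final (Rewind g) (stack_tape s j) (row_tape l r) w ->
        exists n, run g s (rev l ++ r) n &
      forall e (q : dfa_state (D e)) s j l r,
        final (Pass q) (stack_tape s j) (row_tape l r) w ->
        exists r' n, [/\ size r = size r',
          dfa_final (foldl (@dfa_next _ (D e)) q (zip r r')) &
          run (next e) s (rev l ++ r') n]].
Proof.
elim: w => [|b w [IHready IHsent IHrew IHpass]].
  split=> // g s j r /= /andP [/eqP -> s0].
  exists 0; case: s s0 => [_|//]; exact: RunAccept.
split.
- move=> g s j r; rewrite final_cons.
  case: b => [[a|]|[c|]] /=; rewrite ?final_Fail //.
    case: s => [|a' s]; first by rewrite /= final_Fail.
    rewrite /=; case: eqP => [E|]; last by rewrite final_Fail.
    case: E => -> {a'}.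
    rewrite -[X in final _ X _ _]/(tape_move None
      (stack_tape (a :: s) j) MoveL).
    rewrite stack_tape_pop /tape_act /= !tape_write_cur ?tape_stay.
    case/IHpass => r' [n [sz F R]]; exists n.+1.
    by apply: (@RunStep _ _ _ _ _ _ g (Some a) _ _ r') => //; apply/DP.
  rewrite /tape_act /= !tape_write_cur ?tape_stay.
  case/IHpass => r' [n [sz F R]]; exists n.+1.
  by apply: (@RunStep _ _ _ _ _ _ g None _ _ r') => //; apply/DP.
- move=> g s j r; rewrite final_cons /= /tape_act /= !tape_write_cur ?tape_stay.
  rewrite -[X in final _ _ X _]/(tape_move None (sentinel_tape r) MoveR).
  by rewrite sentinel_tape_right; apply: IHready.
- move=> g s j l r; rewrite final_cons /= (negbTE (row_tape_cur l r)).
  rewrite /tape_act /= !tape_write_cur ?tape_stay.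
  case: l => [|c l]; first by rewrite row_tape_left0; apply: IHsent.
  by rewrite row_tape_left rev_cons cat_rcons; apply: IHrew.
- move=> e q s j l r; rewrite final_cons.
  case: b => [a|[c'|]]; first by case: a => [?|] /=; rewrite final_Fail.
    case: r => [|c r]; first by rewrite /= final_Fail.
    rewrite /= /tape_act /= !tape_write_cur ?tape_stay.
    rewrite -[X in final _ _ X _]/(tape_move None
      (tape_write (row_tape l (c :: r)) (cel c')) MoveR).
    rewrite row_tape_write => /IHpass [r' [n [sz F R]]].
    exists (c' :: r'), n; split=> //=; first by rewrite sz.
    by move: R; rewrite rev_cons cat_rcons.
  (* A pass may end only on the blank behind the row, so the new row has the length of the old
     one. *)
  case: r => [|c r] /=; last by rewrite final_Fail.
  case: ifP => [Fq|]; last by rewrite final_Fail.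
  rewrite /tape_act /= !tape_write_cur ?tape_stay.
  rewrite -[X in final _ _ X _]/(tape_move None (row_tape l [::]) MoveL).
  case: l => [|c l].
    rewrite row_tape_left0 => /IHsent [n R]; by exists [::], n.
  rewrite row_tape_left => /IHrew [n R]; exists [::], n; split=> //.
  by rewrite rev_cons cats0 -cats1.
Qed.

Lemma row_tape_append l c :
  tape_move None (tape_write (row_tape l [::]) (cel c)) MoveR
    = row_tape (c :: l) [::].
Proof. by []. Qed.

Lemma final_init_sound w l s j :
  final Init (stack_tape s j) (row_tape l [::]) w ->
  exists r n, run g0 s r n.
Proof.
elim: w l j => [//|b w IH] l j; rewrite final_cons.
case: b => [a|[c|]]; rewrite /= ?final_Fail //.
  rewrite /tape_act /= !tape_write_cur ?tape_stay row_tape_append.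
  exact: IH.
rewrite /tape_act /= !tape_write_cur ?tape_stay.
have [_ sent rew _] := final_sound w.
case: l => [|c l]; first by rewrite row_tape_left0 => /sent; exists [::].
by rewrite row_tape_left => /rew; exists (rev l ++ [:: c]).
Qed.

(** It takes [size l] moves to reach the first cell, one more to reach the sentinel and one to step
    back from it. *)
Lemma final_rewind g s j l r w :
  final (Rewind g) (stack_tape s j) (row_tape l r)
    (nseq (size l).+2 (inr None) ++ w)
  = final (Ready g) (stack_tape s j) (row_tape [::] (rev l ++ r)) w.
Proof.
elim: l r => [|c l IH] r; rewrite final_cons /= (negbTE (row_tape_cur [::] _)).
  rewrite /tape_act /= !tape_write_cur tape_stay row_tape_left0 final_cons.
  by rewrite /= /tape_act /= !tape_write_cur tape_stay sentinel_tape_right.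
rewrite /tape_act /= !tape_write_cur tape_stay row_tape_left.
rewrite -[X in final _ _ _ X]/(nseq (size l).+2 _ ++ w) IH.
by rewrite rev_cons cat_rcons.
Qed.

Lemma final_pass e (q : dfa_state (D e)) s j l r r' w :
  size r = size r' ->
  final (Pass q) (stack_tape s j) (row_tape l r)
    ([seq inr (Some c) | c <- r'] ++ w)
  = final (Pass (foldl (@dfa_next _ (D e)) q (zip r r')))
      (stack_tape s j) (row_tape (rev r' ++ l) [::]) w.
Proof.
elim: r r' q l => [|c r IH] [|c' r'] q l //= [sz].
rewrite final_cons /= /tape_act /= !tape_write_cur ?tape_stay.
by rewrite row_tape_write IH // rev_cons cat_rcons.
Qed.

(** Each step of the run costs one letter for the announcement, [size r] for the new row, one for
    its end and [size r + 1] for the rewinding. *)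
Lemma final_complete g s r n j : run g s r n ->
  exists2 w, size w <= n * (2 * size r + 3) &
    final (Ready g) (stack_tape s j) (row_tape [::] r) w.
Proof.
move=> R; elim: R j => {g s r n} [r n|g a s r r' n sz R _ IH] j.
  by exists [::] => //; apply/andP; split.
pose j' := if a is Some b then stk b :: j else j.
have [w sw fw] := IH j'.
exists ((inl a : B) :: [seq inr (Some c) | c <- r'] ++
    inr None :: nseq (size r').+1 (inr None) ++ w).
  move: sw; rewrite -sz [n.+1 * _]mulSn; set N := n * _.
  rewrite /= !size_cat /= size_cat size_map size_nseq -sz; lia.
have E : final (Pass (dfa_start (D (g, a)))) (stack_tape s j')
    (row_tape [::] r) ([seq inr (Some c) | c <- r'] ++
    inr None :: nseq (size r').+1 (inr None) ++ w).
  rewrite final_pass // final_cons /= cats0.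
  move/(DP (g, a) sz): R; rewrite /dfa_accepts => ->.
  rewrite /tape_act /= !tape_write_cur ?tape_stay.
  (* The end marker has already moved the head left: onto the last cell, or onto the sentinel if the
     row is empty. *)
  case/lastP: r' sz fw {sw IH} => [|r' c] sz fw.
    rewrite row_tape_left0 /= final_cons /= /tape_act /= !tape_write_cur.
    by rewrite tape_stay sentinel_tape_right.
  rewrite rev_rcons row_tape_left size_rcons -(size_rev r').
  by rewrite final_rewind revK cats1.
rewrite final_cons; case: a @j' R {fw IH} E => [a|] j' R E.
  rewrite /= eqxx /tape_act /= ?tape_write_cur ?tape_stay.
  by rewrite -[MkTape _ _ _]/(stack_tape (a :: s) j) stack_tape_pop.
by rewrite /= /tape_act /= !tape_write_cur !tape_stay.
Qed.

Lemma final_init_row s j l r w :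
  final Init (stack_tape s j) (row_tape l [::])
    ([seq inr (Some c) | c <- r] ++ w)
  = final Init (stack_tape s j) (row_tape (rev r ++ l) [::]) w.
Proof.
elim: r l => [//|c r IH] l; rewrite /= final_cons /= /tape_act /=.
by rewrite tape_write_cur tape_stay row_tape_append IH rev_cons cat_rcons.
Qed.

Lemma final_init_complete s j r n : run g0 s r n ->
  exists2 w, size w <= n.+1 * (2 * size r + 3) &
    final Init (stack_tape s j) (row_tape [::] [::]) w.
Proof.
move=> /(final_complete j) [w sw fw].
exists ([seq inr (Some c) | c <- r] ++
    inr None :: nseq (size r).+1 (inr None) ++ w).
  move: sw; rewrite [n.+1 * _]mulSn; set N := n * _.
  rewrite !size_cat /= size_cat size_map size_nseq; lia.
rewrite final_init_row cats0 final_cons /= /tape_act /= !tape_write_cur.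
rewrite tape_stay.
case/lastP: r fw {sw} => [|r c] fw.
  rewrite row_tape_left0 /= final_cons /= /tape_act /= !tape_write_cur.
  by rewrite tape_stay sentinel_tape_right.
rewrite rev_rcons row_tape_left size_rcons -(size_rev r).
by rewrite final_rewind revK cats1.
Qed.

Lemma copy_stack x l t2 :
  foldl step (Copy, (MkTape l None [::], t2)) [seq inl a | a <- x]
    = (Copy, (MkTape ([seq stk a | a <- rev x] ++ l) None [::], t2)).
Proof.
elim: x l => [//|a x IH] l /=.
rewrite /tape_act /= !tape_write_cur ?tape_stay.
rewrite -[tape_move _ _ _]/(MkTape (stk a :: l) None [::]) IH.
by rewrite rev_cons map_rcons cat_rcons.
Qed.

(** The first letter of the certificate, whatever it is, ends the copying. The top of the stack is
    then the last input symbol, hence [rev x]; the blank in [[:: None]] is the cell where copying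
    stopped. *)
Lemma accepts_pair_word x w :
  rt_accepts Copy act fin (pair_word x w) =
    if w is _ :: w' then
      final Init (stack_tape (rev x) [:: None]) (row_tape [::] [::]) w'
    else false.
Proof.
rewrite /rt_accepts /pair_word foldl_cat copy_stack cats0.
case: w => [//|b w] /=; rewrite -/step /tape_act /=.
by case: (rev x).
Qed.

Theorem row_system_verifier :
  exists2 V : seq (A + B) -> Prop, in_P V &
    forall x,
      (forall w, V (pair_word x w) -> exists r n, run g0 (rev x) r n) /\
      (forall r n, run g0 (rev x) r n ->
        exists2 w, size w <= n.+1 * (2 * size r + 3) + 1 &
          V (pair_word x w)).
Proof.
exists (fun z => rt_accepts Copy act fin z); first exact: rt_in_P.
move=> x; split=> [w|r n R].
  rewrite accepts_pair_word; case: w => // _ w.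
  exact: final_init_sound.
have [w sw fw] := final_init_complete [:: None] R.
exists (inr None :: w); first by rewrite /= addn1.
by rewrite accepts_pair_word.
Qed.

End Verifier.

(** Converts bounds in [(size x).+1], which is never zero, into the form [c * size x ^ d + c] of
    [in_NP]. For positive [n] it rests on [n.+1 <= 2 * n]. *)
Lemma expSn_le n k : n.+1 ^ k <= 2 ^ k * n ^ k + 1.
Proof.
case: n => [|n]; first by rewrite exp1n addn1.
rewrite -expnMn (leq_trans _ (leq_addr _ _)) //.
by elim: k => // k IH; rewrite !expnS leq_mul //; lia.
Qed.

Theorem row_system_in_NP (L : seq A -> Prop) (c d : nat) :
  (forall e, regular2 (rule e)) ->
  (forall x r n, run g0 (rev x) r n -> L x) ->
  (forall x, L x -> exists r n, [/\ run g0 (rev x) r n,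
     size r <= c * (size x).+1 ^ d & n <= c * (size x).+1 ^ d]) ->
  in_NP L.
Proof.
move=> reg sound complete.
(* Finite choice of one automaton for each of the finitely many [e]. *)
have [D DP] : exists D : G * option A -> dfa (C * C), forall e r r',
    size r = size r' -> dfa_accepts (D e) (zip r r') <-> rule e r r'.
  exact: (fin_all_exists reg).
have [V VP VE] := row_system_verifier DP.
(* With [X = (size x).+1 ^ d], the factors [n.+1] and [2 * size r + 3] are at most [c.+1 * X] and
   [5 * (c.+1 * X)]; the sixth unit absorbs the final [+ 1]. *)
pose k := 6 * c.+1 * c.+1.
exists (option A + option C)%type, V, (k * 2 ^ (d + d)), (d + d); split=> //.
move=> x; have [Vs Vc] := VE x; split=> [Lx|[w [_ /Vs [r [n]]]]]; last first.
  exact: sound.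
have [r [n [R sr sn]]] := complete x Lx.
have [w sw Vw] := Vc _ _ R.
exists w; split=> //.
have := expSn_le (size x) (d + d); rewrite [_.+1 ^ _]expnD.
set X := _.+1 ^ d in sr sn *; set Y := size x ^ _.
have X1 : 0 < X by rewrite expn_gt0.
have Z1 : 0 < 2 ^ (d + d) by rewrite expn_gt0.
move: (2 ^ (d + d)) Z1 => Z Z1 XY.
have XXk : k * (X * X) <= k * Z * Y + k * Z.
  by rewrite -mulnA -mulnDr leq_mul // (leq_trans XY) // leq_add2l.
apply: leq_trans XXk; apply: leq_trans sw _.
have n_le : n.+1 <= c.+1 * X by rewrite mulSn; lia.
have r_le : 2 * size r + 3 <= 5 * (c.+1 * X) by rewrite mulSn; lia.
have := leq_mul n_le r_le; have : 0 < c.+1 * X by rewrite muln_gt0.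
by rewrite /k; nia.
Qed.

End RowSystem.

(** * Finite-state relations between rows *)

#[local] Arguments Z.mul : simpl never.
#[local] Arguments Z.add : simpl never.

Section Regular.

Variable C : finType.
Implicit Types (P Q : seq C -> seq C -> Prop) (F H : seq C -> seq C -> Z).

Lemma regular2_false : regular2 (fun _ _ : seq C => False).
Proof.
by exists (@MkDfa (C * C) unit tt (fun _ _ => tt) pred0).
Qed.

Lemma foldl_pair (S T : Type) (f : S -> C * C -> S) (g : T -> C * C -> T)
    s x y :
  foldl (fun q c => (f q.1 c, g q.2 c)) (x, y) s = (foldl f x s, foldl g y s).
Proof. by elim: s x y => //= c s IH x y; rewrite IH. Qed.

Lemma regular2_and P Q :
  regular2 P -> regular2 Q -> regular2 (fun r r' => P r r' /\ Q r r').
Proof.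
move=> [D DP] [E EQ].
exists (@MkDfa _ (dfa_state D * dfa_state E)%type (dfa_start D, dfa_start E)
  (fun q c => (dfa_next q.1 c, dfa_next q.2 c))
  (fun q => dfa_final q.1 && dfa_final q.2)) => r r' sz.
rewrite -DP // -EQ // /dfa_accepts /= foldl_pair /=.
by split=> [/andP|[-> ->]].
Qed.

Lemma regular2_or P Q :
  regular2 P -> regular2 Q -> regular2 (fun r r' => P r r' \/ Q r r').
Proof.
move=> [D DP] [E EQ].
exists (@MkDfa _ (dfa_state D * dfa_state E)%type (dfa_start D, dfa_start E)
  (fun q c => (dfa_next q.1 c, dfa_next q.2 c))
  (fun q => dfa_final q.1 || dfa_final q.2)) => r r' sz.
rewrite -DP // -EQ // /dfa_accepts /= foldl_pair /=.
by split=> [/orP|/orP].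
Qed.

Lemma regular2_iff P Q :
  (forall r r', size r = size r' -> P r r' <-> Q r r') ->
  regular2 P -> regular2 Q.
Proof.
by move=> PQ [D DP]; exists D => r r' sz; rewrite DP // PQ.
Qed.

Lemma regular2_all (p : pred (C * C)) :
  regular2 (fun r r' => all p (zip r r')).
Proof.
exists (@MkDfa _ bool true (fun q c => q && p c) id) => r r' _.
rewrite /dfa_accepts /=; set s := zip r r'.
suff -> b : foldl (fun q c => q && p c) b s = b && all p s by [].
by elim: s b => [|c s IH] b /=; rewrite ?andbT // IH andbA.
Qed.

Lemma regular2_all_old (p : pred C) : regular2 (fun r _ => all p r).
Proof.
apply: regular2_iff (regular2_all (fun c => p c.1)) => r r' sz.
by rewrite -(all_map fst) -/(unzip1 _) unzip1_zip // sz.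
Qed.

Lemma regular2_has_new (p : pred C) : regular2 (fun _ r => has p r).
Proof.
exists (@MkDfa _ bool false (fun q c => q || p c.2) id) => r r' sz.
rewrite /dfa_accepts /=.
rewrite -[r' in _ <-> is_true (has p r')](@unzip2_zip _ _ r) ?sz //.
rewrite has_map; set s := zip r r'.
suff -> b : foldl (fun q c => q || p c.2) b s = b || has (preim snd p) s by [].
by elim: s b => [|c s IH] b /=; rewrite ?orbF // IH orbA.
Qed.

Lemma regular2_map_eq (T : eqType) (f : C -> T) :
  regular2 (fun r r' => map f r' = map f r).
Proof.
apply: regular2_iff (regular2_all (fun c => f c.2 == f c.1)) => r r'.
elim: r r' => [|c r IH] [|c' r'] //= [/IH {}IH].
split=> [/andP [/eqP -> /IH -> //]|[-> /IH ->]].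
by rewrite eqxx.
Qed.

(** The state [Some b] holds the value [b] that [f] must take on the next new cell; [None] records a
    mismatch. *)
Lemma regular2_shift (f p : C -> bool) :
  regular2 (fun r r' => map f r' = belast false (map p r)).
Proof.
exists (@MkDfa _ (option bool) (Some false)
  (fun q c => if q == Some (f c.2) then Some (p c.1) else None) isSome).
rewrite /dfa_accepts /=; move: false => b r.
elim: r b => [|c r IH] b [|c' r'] //= [sz].
case: eqP => [[->]|bf]; first by rewrite IH //; split=> [->|[]].
have -> s : foldl (fun q c => if q == Some (f c.2) then Some (p c.1) else None)
    None s = None by elim: s.
by split=> // -[E]; case: bf; rewrite E.
Qed.

Lemma regular2_last_old (p : pred C) :
  regular2 (fun r _ => ~~ last false (map p r)).
Proof.
exists (@MkDfa _ bool false (fun _ c => p c.1) negb) => r r'.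
rewrite /dfa_accepts /=; move: false => b.
by elim: r r' b => [|c r IH] [|c' r'] b //= [/IH].
Qed.

(** A number with its least significant digit first, whose digits may be any integers: integer
    combinations of binary registers are again of this form. *)
Definition wsum (T : Type) (f : T -> Z) (s : seq T) : Z :=
  foldr (fun c z => (f c + 2 * z)%Z) 0%Z s.

Definition linear F : Prop := exists (f : C * C -> Z) (k : Z),
  forall r r', size r = size r' -> F r r' = (k + wsum f (zip r r'))%Z.

Lemma linear_const k : linear (fun _ _ => k).
Proof.
exists (fun _ => 0%Z), k => r r' _; elim: (zip _ _) => //=; lia.
Qed.

Lemma linear_add F H :
  linear F -> linear H -> linear (fun r r' => (F r r' + H r r')%Z).
Proof.
move=> [f [k FE]] [h [l HE]].
exists (fun c => (f c + h c)%Z), (k + l)%Z => r r' sz; rewrite FE // HE //.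
elim: (zip _ _) => [|c s] /=; lia.
Qed.

Lemma linear_scale k F : linear F -> linear (fun r r' => (k * F r r')%Z).
Proof.
move=> [f [l FE]].
exists (fun c => (k * f c)%Z), (k * l)%Z => r r' sz; rewrite FE //.
elim: (zip _ _) => [|c s] /=; nia.
Qed.

Lemma linear_old (f : C -> Z) : linear (fun r _ => wsum f r).
Proof.
exists (fun c => f c.1), 0%Z => r r'.
elim: r r' => [|c r IH] [|c' r'] //= [/IH ->]; lia.
Qed.

Lemma linear_new (f : C -> Z) : linear (fun _ r => wsum f r).
Proof.
exists (fun c => f c.2), 0%Z => r r'.
elim: r r' => [|c r IH] [|c' r'] //= [/IH ->]; lia.
Qed.

(* Scanning from the least significant position, the state is the carry
   [floor ((k + prefix sum) / 2^i)], which never exceeds the largest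
   coefficient in absolute value. *)
Lemma regular2_ge0 F : linear F -> regular2 (fun r r' => (0 <= F r r')%Z).
Proof.
move=> [f [k FE]].
pose M := maxn (Z.abs_nat k) (\max_c Z.abs_nat (f c)).
have fM c : Z.abs_nat (f c) <= M.
  by rewrite leq_max (leq_bigmax (F := fun c => Z.abs_nat (f c))) orbT.
have kM : Z.abs_nat k <= M by rewrite leq_max leqnn.
move: M fM kM => M fM kM.
have {}fM c : (- Z.of_nat M <= f c <= Z.of_nat M)%Z by have := fM c; lia.
have {}kM : (- Z.of_nat M <= k <= Z.of_nat M)%Z by lia.
pose dec (q : 'I_(2 * M).+1) := (Z.of_nat q - Z.of_nat M)%Z.
pose enc (z : Z) : 'I_(2 * M).+1 := inord (Z.to_nat (z + Z.of_nat M)).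
have encK z : (- Z.of_nat M <= z <= Z.of_nat M)%Z -> dec (enc z) = z.
  by move=> zM; rewrite /dec /enc inordK; lia.
exists (@MkDfa _ 'I_(2 * M).+1 (enc k)
  (fun q c => enc ((dec q + f c) / 2)%Z) (fun q => (0 <=? dec q)%Z)).
move=> r r' sz; rewrite FE // /dfa_accepts /=.
elim: (zip r r') k kM {FE sz} => [|c s IH] k kM /=.
  rewrite encK //; lia.
(* With rounding down, [k + f c + 2 * z] is nonnegative iff [(k + f c) / 2 + z] is, and the new
   carry stays between [- M] and [M]. *)
have := Z.div_mod (k + f c) 2; have := Z.mod_pos_bound (k + f c) 2.
have := fM c; rewrite encK // => fcM mod2 div2.
rewrite IH; lia.
Qed.

Lemma regular2_le F H :
  linear F -> linear H -> regular2 (fun r r' => (F r r' <= H r r')%Z).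
Proof.
move=> lF lH; have := regular2_ge0 (linear_add lH (linear_scale (-1) lF)).
by apply: regular2_iff => r r' _; lia.
Qed.

Lemma regular2_lt F H :
  linear F -> linear H -> regular2 (fun r r' => (F r r' < H r r')%Z).
Proof.
move=> lF lH; have := regular2_le (linear_add lF (linear_const 1)) lH.
by apply: regular2_iff => r r' _; lia.
Qed.

Lemma regular2_eq F H :
  linear F -> linear H -> regular2 (fun r r' => F r r' = H r r').
Proof.
move=> lF lH; have := regular2_and (regular2_le lF lH) (regular2_le lH lF).
by apply: regular2_iff => r r' _; lia.
Qed.

End Regular.

(** * The row system of modular constraints *)

#[local] Arguments Z.modulo : simpl never.

Definition tsym : Type := (bool + bool)%type.
Definition bit (b : bool) : tsym := inl b.
Definition entry_start : tsym := inr false.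
Definition entry_colon : tsym := inr true.

Definition cell : Type :=
  ((bool * bool) * (bool * bool) * (tsym * bool))%type.
Definition cell_sym (c : cell) : tsym := c.2.1.
Definition cell_mark (c : cell) : bool := c.2.2.

Definition regN (r : seq cell) : Z := wsum (fun c => Z.b2z c.1.1.1) r.
Definition regK (r : seq cell) : Z := wsum (fun c => Z.b2z c.1.1.2) r.
Definition regV (r : seq cell) : Z := wsum (fun c => Z.b2z c.1.2.1) r.
Definition regY (r : seq cell) : Z := wsum (fun c => Z.b2z c.1.2.2) r.
Definition table (r : seq cell) : seq tsym := map cell_sym r.
Definition marks (r : seq cell) : seq bool := map cell_mark r.

(** Read backwards, a constraint shows its right constant, right variable, relation, left constant
    and left variable, as far as present. [Bound] stands at the end of the text of a constraint or
    of the modulus; [Value] guesses the bits of a looked-up value. *)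
Variant phase :=
  Bound | NumStart | NumBits | VarStart | NameStart | NameBits | Value |
  ModBits | Accept.

Definition phases : seq phase :=
  [:: Bound; NumStart; NumBits; VarStart; NameStart; NameBits; Value;
      ModBits; Accept].

Definition phase_code (p : phase) : 'I_9 :=
  inord (match p with
  | Bound => 0 | NumStart => 1 | NumBits => 2 | VarStart => 3 | NameStart => 4
  | NameBits => 5 | Value => 6 | ModBits => 7 | Accept => 8
  end).

Lemma phase_codeK : cancel phase_code (fun i => nth Bound phases i).
Proof. by case; rewrite /phase_code /= inordK. Qed.

HB.instance Definition _ := Finite.copy phase (can_type phase_codeK).

(* While a constraint is read, the second component is [None] until its
   relation symbol has been met, and that symbol afterwards. *)
Definition control : Type := (phase * option symbol)%type.

Definition compares (rel : symbol) (u v : Z) : Prop :=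
  match rel with
  | SLe => (u <= v)%Z
  | SGe => (v <= u)%Z
  | SLt => (u < v)%Z
  | SGt => (v < u)%Z
  | SEq => u = v
  | _ => False
  end.

(** For [u] between 0 and [2 * regN r] and nonnegative [v], this makes [v] the residue of [u]: one
    subtraction suffices, so only linear relations are involved. *)
Definition reduces (r : seq cell) (u v : Z) : Prop :=
  (v < regN r)%Z /\ (u = v \/ u = (v + regN r)%Z).

Definition keeps (r r' : seq cell) : Prop :=
  regK r' = regK r /\ regY r' = regY r.

(** A mark says that the string read so far occurs just before the marked cell. Hence marks move one
    cell to the right when a symbol is read, and a mark leaving the last cell is lost. *)
Definition starts_match (r r' : seq cell) : Prop :=
  marks r' = belast false [seq cell_sym c == entry_start | c <- r].

Definition extends_match (x : tsym) (r r' : seq cell) : Prop :=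
  marks r' = belast false [seq cell_mark c && (cell_sym c == x) | c <- r].

Definition forces_match (x : tsym) (r : seq cell) : Prop :=
  all (fun c => cell_mark c ==> (cell_sym c == x)) r.

Definition adds_digit (b : bool) (r r' : seq cell) : Prop :=
  reduces r (2 * regK r + Z.b2z b) (regK r') /\ regY r' = regY r.

(** Every occurrence of the name must show the same bit, and no mark may run off the row. *)
Definition reads_value_bit (b : bool) (r r' : seq cell) : Prop :=
  (~~ last false (marks r) /\ forces_match (bit b) r) /\
  (extends_match (bit b) r r' /\ regV r' = (2 * regV r + Z.b2z b)%Z).

Definition ends_value (r : seq cell) (v : Z) : Prop :=
  forces_match entry_start r /\
  ((regV r < regN r)%Z /\ reduces r (regV r + regK r) v).

(** Registers that neither the rule nor [static] mentions may change freely. The modulus is guessed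
    in the first row and confirmed only by the last rule, once its digits have been read. The
    relation of [stuck] is empty, so its accepting target is harmless. *)
Definition transition (e : control * option symbol) :
    control * (seq cell -> seq cell -> Prop) :=
  let: ((ph, c), a) := e in
  let stuck := ((Accept, None), fun _ _ => False) in
  match ph, a with
  | Bound, None => ((NumStart, None), fun _ r' => regK r' = 0%Z)
  | Bound, Some Bit1 => ((ModBits, None), fun _ r' => regK r' = 1%Z)
  | NumStart, Some Bit1 => ((NumBits, c), adds_digit true)
  | NumStart, Some Plus => ((VarStart, c), keeps)
  | NumBits, Some Bit0 => ((NumBits, c), adds_digit false)
  | NumBits, Some Bit1 => ((NumBits, c), adds_digit true)
  | NumBits, Some Plus => ((VarStart, c), keeps)
  | NumBits, Some Minus => ((VarStart, c), fun r r' =>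
      regY r' = regY r /\ ((regK r' < regN r)%Z /\
      ((regK r + regK r' = 0)%Z \/ (regK r + regK r' = regN r)%Z)))
  | VarStart, None => ((NameStart, c), fun r r' =>
      keeps r r' /\ starts_match r r')
  | VarStart, Some rel =>
      if (c == None) && (rel \in [:: SLe; SGe; SLt; SGt; SEq]) then
        ((VarStart, Some rel), fun r r' =>
          regY r' = regK r /\ regK r' = 0%Z)
      else stuck
  | NameStart, Some Bit1 => ((NameBits, c), fun r r' =>
      keeps r r' /\ extends_match (bit true) r r')
  | NameBits, Some Bit0 => ((NameBits, c), fun r r' =>
      keeps r r' /\ extends_match (bit false) r r')
  | NameBits, Some Bit1 => ((NameBits, c), fun r r' =>
      keeps r r' /\ extends_match (bit true) r r')
  | NameBits, Some SVar => ((Value, c), fun r r' =>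
      keeps r r' /\ (extends_match entry_colon r r' /\
      (has cell_mark r' /\ regV r' = 0%Z)))
  | Value, None => ((Value, c), fun r r' =>
      keeps r r' /\ (reads_value_bit false r r' \/ reads_value_bit true r r'))
  | Value, Some a =>
      if c is Some rel then
        if a == Sep then
          ((Bound, None), fun r r' =>
            ends_value r (regK r') /\ compares rel (regK r') (regY r))
        else stuck
      else if a \in [:: SLe; SLt; SEq] then
        ((NumStart, Some a), fun r r' =>
          ends_value r (regY r') /\ regK r' = 0%Z)
      else stuck
  | ModBits, Some Bit0 => ((ModBits, None), fun r r' =>
      regK r' = (2 * regK r)%Z)
  | ModBits, Some Bit1 => ((ModBits, None), fun r r' =>
      regK r' = (2 * regK r + 1)%Z)
  | ModBits, None => ((Accept, None), fun r _ => regK r = regN r)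
  | _, _ => stuck
  end.

Definition next (e : control * option symbol) : control := (transition e).1.

Definition static (r r' : seq cell) : Prop :=
  table r' = table r /\ (regN r' = regN r /\ (0 < regN r)%Z).

Definition rule (e : control * option symbol) (r r' : seq cell) : Prop :=
  static r r' /\ (transition e).2 r r'.

Lemma rule_regular e : regular2 (rule e).
Proof.
have cst := @linear_const cell.
have N1 := @linear_old cell (fun c => Z.b2z c.1.1.1).
have N2 := @linear_new cell (fun c => Z.b2z c.1.1.1).
have K1 := @linear_old cell (fun c => Z.b2z c.1.1.2).
have K2 := @linear_new cell (fun c => Z.b2z c.1.1.2).
have V1 := @linear_old cell (fun c => Z.b2z c.1.2.1).
have V2 := @linear_new cell (fun c => Z.b2z c.1.2.1).
have Y1 := @linear_old cell (fun c => Z.b2z c.1.2.2).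
have Y2 := @linear_new cell (fun c => Z.b2z c.1.2.2).
have lin2 := fun F (lF : linear F) => linear_scale 2 lF.
have start : regular2 starts_match := regular2_shift _ _.
have ext x : regular2 (extends_match x) := regular2_shift _ _.
have force x : regular2 (fun r _ => forces_match x r) := regular2_all_old _.
have marked := @regular2_has_new cell cell_mark.
have addl := @linear_add cell.
have red F G : linear F -> linear G ->
    regular2 (fun r r' => reduces r (F r r') (G r r')).
  move=> lF lG; apply: regular2_and; first exact: regular2_lt.
  apply: regular2_or; apply: regular2_eq => //; exact: linear_add.
have keep : regular2 keeps by apply: regular2_and; exact: regular2_eq.
have dig b : regular2 (adds_digit b).
  apply: regular2_and; last exact: regular2_eq.
  by apply: red => //; apply: addl => //; exact: lin2.
have vbit b : regular2 (reads_value_bit b).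
  do 2!apply: regular2_and => //; first exact: regular2_last_old.
  by apply: regular2_eq => //; apply: addl => //; exact: lin2.
have ends G : linear G -> regular2 (fun r r' => ends_value r (G r r')).
  move=> lG; do 2!apply: regular2_and => //; first exact: regular2_lt.
  by apply: red => //; exact: addl.
have cmp rel : regular2 (fun r r' => compares rel (regK r') (regY r)).
  case: rel => /=; by [exact: regular2_false | exact: regular2_le
    | exact: regular2_lt | exact: regular2_eq].
apply: regular2_and.
  apply: regular2_and; first exact: regular2_map_eq.
  by apply: regular2_and; [exact: regular2_eq | exact: regular2_lt].
have if_regular b (u w : control * (seq cell -> seq cell -> Prop)) :
  regular2 u.2 -> regular2 w.2 -> regular2 (if b then u else w).2 by case: b.
have never := @regular2_false cell.
case: e => [[ph c] a]; case: ph; case: a => [a|] //=; try by case: a => //=.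
all: try (case: a => //=; try case: c => //=).
all: try move=> ?.
all: repeat first [ by [] | exact: red | exact: ends | exact: cmp
  | apply: if_regular | apply: regular2_and | apply: regular2_or
  | apply: regular2_eq | apply: regular2_lt | apply: addl | apply: lin2 ].
Qed.

(** * Variable names and lookup in the table *)

Fixpoint name_bits (p : positive) : seq bool :=
  match p with
  | xH => [:: true]
  | xO q => rcons (name_bits q) false
  | xI q => rcons (name_bits q) true
  end.

(** Both delimiters belong to the key, so that a name is never found inside a longer one. *)
Definition entry_key (p : positive) : seq tsym :=
  entry_start :: rcons (map bit (name_bits p)) entry_colon.

(* The positions of the table that come just after an occurrence of [s]. *)
Definition matches (t s : seq tsym) : seq bool :=
  [seq suffix s (take i t) | i <- iota 0 (size t)].

Fixpoint leading_value (v : Z) (s : seq tsym) : Z :=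
  if s is inl b :: s' then leading_value (2 * v + Z.b2z b)%Z s' else v.

(** The first occurrence of the key is as good as any other: an accepting run that reads the name
    forces all its occurrences to show the same value. *)
Definition lookup (t : seq tsym) (p : positive) : Z :=
  leading_value 0 (drop (find id (matches t (entry_key p))) t).

Lemma size_matches t s : size (matches t s) = size t.
Proof. by rewrite size_map size_iota. Qed.

Lemma nth_matches t s i : i < size t ->
  nth false (matches t s) i = suffix s (take i t).
Proof. by move=> it; rewrite (nth_map 0) ?size_iota // nth_iota. Qed.

Lemma nth_belast (T : Type) (x0 x : T) s i : i < size s ->
  nth x0 (belast x s) i = nth x0 (x :: s) i.
Proof. by move=> si; rewrite lastI nth_rcons size_belast si. Qed.

(** An occurrence of [rcons s x] ends just before [i.+1] iff one of [s] ends just before [i] and the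
    symbol at [i] is [x]; none ends before position 0, since [rcons s x] is not empty. *)
Lemma matches_rcons t s x (b : seq bool) : size b = size t ->
  (forall i, i < size t ->
     nth false b i = suffix s (take i t) && (nth x t i == x)) ->
  belast false b = matches t (rcons s x).
Proof.
move=> sb bE; apply: (@eq_from_nth _ false).
  by rewrite size_belast size_matches.
rewrite size_belast sb => i it; rewrite nth_belast ?sb // nth_matches //.
case: i it => [|i] it /=; first by rewrite take0 suffixs0; case: (s).
rewrite bE ?(ltnW it) // (take_nth x) ?(ltnW it) //.
by rewrite suffix_rcons eq_sym andbC.
Qed.

Lemma matches_start r : belast false [seq cell_sym c == entry_start | c <- r]
  = matches (table r) [:: entry_start].
Proof.
rewrite -[[:: _]]/(rcons [::] entry_start); apply: matches_rcons.
  by rewrite !size_map.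
move=> i; rewrite size_map => ir; case: r ir => // c r ir.
by rewrite suffix0s !(nth_map c).
Qed.

Lemma matches_extend t r s x : table r = t -> marks r = matches t s ->
  belast false [seq cell_mark c && (cell_sym c == x) | c <- r]
  = matches t (rcons s x).
Proof.
move=> <- mr; apply: matches_rcons; first by rewrite !size_map.
move=> i ir; rewrite -nth_matches // -mr; move: ir; rewrite size_map => ir.
by case: r ir {mr} => // c r ir; rewrite !(nth_map c).
Qed.

Lemma reg_ge0 (f : cell -> bool) r : (0 <= wsum (fun c => Z.b2z (f c)) r)%Z.
Proof. by elim: r => //= c r IH; case: (f c) => /=; lia. Qed.

(** * Accepted inputs are satisfiable *)

Section Soundness.

Variables (n : positive) (t : seq tsym).

Definition table_assignment (x : var) : Z := (lookup t x mod Z.pos n)%Z.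
Let a := table_assignment.

Definition good (y : seq symbol) : Prop :=
  exists2 cs, List.Forall (satisfies n a) cs &
    y = flatten [seq Sep :: encode_constraint c | c <- cs].

(** Once a relation has been read, this is a continuation: whatever variable comes next, the text
    extended by it is good if its term compares well with the saved side [v]. Before that, the text
    begins with the right-hand constant, whose residue is [k]. *)
Definition term_inv (c : option symbol) (y : seq symbol) (k v : Z) : Prop :=
  if c is Some rel then
    forall x, compares rel ((a x + k) mod Z.pos n)%Z v ->
      good (Sep :: encode_var x ++ y)
  else exists l y0,
    [/\ y = encode_Z l ++ y0, good y0 & k = (l mod Z.pos n)%Z].

Definition number_inv (c : option symbol) (y : seq symbol) (v : Z) : Prop :=
  forall k, term_inv c (encode_Z k ++ y) (k mod Z.pos n)%Z v.

(* [y] is the suffix of the input read so far. *)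
Definition invariant (g : control) (y : seq symbol) (r : seq cell) : Prop :=
  let c := g.2 in
  match g.1 with
  | Bound => good y
  | NumStart => number_inv c y (regY r) /\ regK r = 0%Z
  | NumBits => exists p y0, [/\ y = encode_pos p ++ y0,
      number_inv c y0 (regY r) & regK r = (Z.pos p mod Z.pos n)%Z]
  | VarStart => term_inv c y (regK r) (regY r)
  | NameStart => term_inv c y (regK r) (regY r) /\
      marks r = matches t [:: entry_start]
  | NameBits => exists p y0, [/\ y = encode_pos p ++ y0,
      term_inv c y0 (regK r) (regY r) &
      marks r = matches t (entry_start :: map bit (name_bits p))]
  | Value => exists p y0 j, [/\ y = encode_var p ++ y0,
      term_inv c y0 (regK r) (regY r),
      nth false (marks r) j &
      leading_value (regV r) (drop j t) = lookup t p]
  | ModBits => exists p y0,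
      [/\ y = encode_pos p ++ y0, good y0 & regK r = Z.pos p]
  | Accept => exists2 y0, good y0 & y = encode_pos n ++ y0
  end.

Lemma reduces_mod r u v : regN r = Z.pos n -> (0 <= v)%Z ->
  reduces r u v -> v = (u mod Z.pos n)%Z.
Proof.
move=> rN v0 []; rewrite rN => vn [->|->].
  by rewrite Z.mod_small.
by rewrite Z.add_mod // Z.mod_same // Z.add_0_r Z.mod_mod // Z.mod_small.
Qed.

Lemma good_cons c y : satisfies n a c -> good y ->
  good (Sep :: encode_constraint c ++ y).
Proof. by move=> sc [cs scs ->]; exists (c :: cs) => //; constructor. Qed.

Lemma adds_digit_mod r r' p b q : regN r = Z.pos n ->
  regK r = (Z.pos p mod Z.pos n)%Z -> adds_digit b r r' ->
  Z.pos q = (2 * Z.pos p + Z.b2z b)%Z ->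
  regK r' = (Z.pos q mod Z.pos n)%Z.
Proof.
move=> rN rK [red _] ->.
by rewrite (reduces_mod rN _ red) ?rK; [|exact: reg_ge0];
  rewrite Z.add_mod // Z.mul_mod_idemp_r // -Z.add_mod.
Qed.

Lemma mark_lt r j : table r = t -> nth false (marks r) j -> j < size t.
Proof.
move=> <-; rewrite size_map ltnNge; case: leqP => // rj.
by rewrite nth_default // size_map.
Qed.

Lemma forces_nth r x j : table r = t ->
  nth false (marks r) j -> forces_match x r -> nth x t j = x.
Proof.
move=> rt mj; have := mark_lt rt mj; rewrite -rt size_map.
case: r {rt} mj => // c r mj jr /(all_nthP c) /(_ j jr).
by move: mj; rewrite !(nth_map c) // => -> /= /eqP.
Qed.

(** The cell [j] is marked, so it shows the guessed bit, and Horner's rule on [regV] agrees with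
    [leading_value]; as the last cell is unmarked, [j.+1] still lies on the row. *)
Lemma invariant_value_bit b r r' j p : table r = t ->
  nth false (marks r) j ->
  leading_value (regV r) (drop j t) = lookup t p ->
  reads_value_bit b r r' ->
  nth false (marks r') j.+1 /\
  leading_value (regV r') (drop j.+1 t) = lookup t p.
Proof.
move=> rt mj <- [[last_r fb] [-> ->]].
have jt := mark_lt rt mj; have tj := forces_nth rt mj fb.
rewrite (drop_nth (bit b) jt) tj /=; split=> //.
have sr : size r = size t by rewrite -rt size_map.
have j1 : j.+1 < size r.
  rewrite ltn_neqAle sr jt andbT -sr; apply: contra last_r => /eqP jr.
  by rewrite (last_nth false) size_map -jr.
rewrite nth_belast ?size_map //=.
case: r {last_r fb} rt mj j1 sr => // c r rt mj j1 sr.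
move: mj tj; rewrite -rt !(nth_map c) ?(ltnW j1) // => -> ->.
by rewrite eqxx.
Qed.

Lemma ends_value_reg r v j p : regN r = Z.pos n -> table r = t ->
  nth false (marks r) j ->
  leading_value (regV r) (drop j t) = lookup t p ->
  (0 <= v)%Z -> ends_value r v -> v = ((a p + regK r) mod Z.pos n)%Z.
Proof.
move=> rN rt mj lv v0 [fs [Vn /(reduces_mod rN v0) ->]].
suff -> : a p = regV r by [].
rewrite /a /table_assignment -lv.
have jt := mark_lt rt mj; have tj := forces_nth rt mj fs.
rewrite (drop_nth entry_start jt) tj /=.
by rewrite Z.mod_small // -rN; split=> //; exact: reg_ge0.
Qed.

Lemma invariant_step g b y r r' : regN r = Z.pos n -> table r = t ->
  rule (g, b) r r' -> invariant g y r -> invariant (next (g, b)) (pop b y) r'.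
Proof.
move=> rN rt [_]; case: g => [ph c].
case: ph; rewrite /next /=.
- case: b => [[]|] //=.
  + by move=> rK gy; exists 1%positive, y.
  + move=> rK gy; split=> // k; exists k, y; split=> //.
- case: b => [[]|] //= R [ny rK].
  + exists 1%positive, y; split=> //; first by rewrite R.2.
    by case: R => red _; rewrite (reduces_mod rN _ red) ?rK //; exact: reg_ge0.
  + by case: R => KK YY; rewrite /invariant /= KK YY rK; apply: (ny 0%Z).
- case: b => [[]|] //= R [p [y0 [-> ny rK]]].
  + exists (xO p), y0; split=> //; first by rewrite R.2.
    exact: adds_digit_mod rN rK R _.
  + exists (xI p), y0; split=> //; first by rewrite R.2.
    exact: adds_digit_mod rN rK R _.
  + by case: R => KK YY; rewrite /invariant /= KK YY rK; apply: (ny (Z.pos p)).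
  + case: R => YY [Kn KK]; suff KE : regK r' = (Z.neg p mod Z.pos n)%Z.
      by rewrite /invariant /= YY KE; exact: (ny (Z.neg p)).
    have K0 : (0 <= regK r')%Z := @reg_ge0 _ _.
    have -> : Z.neg p = (- Z.pos p)%Z by [].
    rewrite rN in Kn KK; rewrite rK in KK.
    have pn := Z.mod_pos_bound (Z.pos p) (Z.pos n) (Pos2Z.is_pos n).
    (* The residue of the opposite is [n] minus the residue, except for residue 0. *)
    case: (Z.eq_dec (Z.pos p mod Z.pos n) 0) => p0.
      rewrite Z.mod_opp_l_z //; move: p0 KK pn Kn K0; clear; lia.
    rewrite Z.mod_opp_l_nz //; move: p0 KK pn Kn K0; clear; lia.
- case: b => [rel|] //=; last first.
    by move=> [[KK YY] mr] ty; rewrite /invariant /= KK YY mr matches_start rt.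
  case: c => [c|] //=.
  case: ifP => // /[!inE] relP [YY KK] [l [y0 [-> gy KE]]].
  rewrite /invariant /= => x; rewrite YY KK KE Z.add_0_r.
  case: rel relP => //= _ cmp.
  + by have := @good_cons (VarLeCst x l) _ cmp gy; rewrite /= -catA.
  + have := @good_cons (VarGeCst x l) _ (Z.le_ge _ _ cmp) gy.
    by rewrite /= -catA.
  + by have := @good_cons (VarLtCst x l) _ cmp gy; rewrite /= -catA.
  + have := @good_cons (VarGtCst x l) _ (Z.lt_gt _ _ cmp) gy.
    by rewrite /= -catA.
  + by have := @good_cons (VarEqCst x l) _ cmp gy; rewrite /= -catA.
- case: b => [[]|] //= [[KK YY] mr] [ty my]; exists 1%positive, y.
  by rewrite KK YY mr (matches_extend _ rt my).
- have name_step q : keeps r r' -> extends_match (bit q) r r' ->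
      invariant (NameBits, c) y r -> exists p y0, [/\ y = encode_pos p ++ y0,
        term_inv c y0 (regK r') (regY r') & marks r' = matches t
          (entry_start :: rcons (map bit (name_bits p)) (bit q))].
    move=> [-> ->] -> [p [y0 [-> ty my]]]; exists p, y0; split=> //.
    by rewrite (matches_extend _ rt my).
  case: b => [[]|] //=.
  + move=> [kp ext] /(name_step _ kp ext) [p [y0 [-> ty my]]].
    by exists (xO p), y0; split=> //; rewrite my map_rcons.
  + move=> [kp ext] /(name_step _ kp ext) [p [y0 [-> ty my]]].
    by exists (xI p), y0; split=> //; rewrite my map_rcons.
  + move=> [[KK YY] [mr [marked V0]]] [p [y0 [-> ty my]]].
    have {}mr : marks r' = matches t (entry_key p).
      by rewrite mr (matches_extend _ rt my).
    (* From here on the first occurrence of the key is followed; it exists because some cell of [r']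
       is marked. *)
    exists p, y0, (find id (matches t (entry_key p))).
    rewrite KK YY V0 mr; split=> //.
    have h : has id (matches t (entry_key p)) by rewrite -mr has_map.
    exact: (nth_find false h).
- case: b => [s|] /=; last first.
    move=> [[KK YY] vb] [p [y0 [j [-> ty mj lv]]]]; rewrite /invariant /=.
    exists p, y0, j.+1; rewrite KK YY.
    by case: vb => vb; have [] := invariant_value_bit rt mj lv vb.
  case: c => [rel|].
    case: eqP => // -> [ev cmp] [p [y0 [j [-> ty mj lv]]]].
    apply: (ty p); rewrite -/a.
    by rewrite -(ends_value_reg rN rt mj lv _ ev) //; exact: reg_ge0.
  case: ifP => // /[!inE] relP [ev KK] [p [y0 [j [-> ty mj lv]]]].
  rewrite /invariant /=; split=> // k x.
  rewrite (ends_value_reg rN rt mj lv _ ev); last exact: reg_ge0.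
  case: ty => l [y1 [-> gy ->]].
  rewrite !Z.add_mod_idemp_r //.
  case: s relP => //= _ cmp.
  + have := @good_cons (VarLeVar x k p l) _ cmp gy.
    by rewrite /= -!catA /= -!catA.
  + have := @good_cons (VarLtVar x k p l) _ cmp gy.
    by rewrite /= -!catA /= -!catA.
  + have := @good_cons (VarEqVar x k p l) _ cmp gy.
    by rewrite /= -!catA /= -!catA.
- case: b => [[]|] //= KK [p [y0 [-> gy pK]]].
  + by exists (xO p), y0; split=> //; rewrite KK pK.
  + by exists (xI p), y0; split=> //; rewrite KK pK.
  (* The numeral just read equals the guessed modulus. *)
  + exists y0 => //; move: KK; rewrite pK rN => -[->]; by [].
- by case: b => [[]|].
Qed.

(** The unread part [s] is reversed, so [rev s ++ y] is the whole input throughout the run. *)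
Lemma run_invariant g s r m y : regN r = Z.pos n -> table r = t ->
  row_run (Accept, None) next rule g s r m -> invariant g y r ->
  exists2 y0, good y0 & rev s ++ y = encode_pos n ++ y0.
Proof.
move=> rN rt run.
elim: run y rN rt => {g s r m} [r m|g b s r r' m sz R _ IH] y rN rt.
  by move=> [y0 gy ->]; exists y0.
move=> /(invariant_step rN rt R) inv.
have [rt' [rN' _]] := R.1.
have [||y0 gy E] := IH _ _ _ inv; rewrite ?rN' ?rt' //.
exists y0 => //; rewrite -E; case: b {R inv IH E} => //= b.
by rewrite rev_cons cat_rcons.
Qed.

End Soundness.

Lemma run_sound x r m :
  row_run (Accept, None) next rule (Bound, None) (rev x) r m ->
  problem_language encode_instance satisfiable x.
Proof.
move=> run; have rpos : (0 < regN r)%Z.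
  (* The run has a first step, as [Bound] is not the accepting phase, and [static] makes [regN r]
     positive there. *)
  by move: run; case E: _ _ _ _ / => [|? ? ? ? ? ? _ [[_ [_ ?]] _] _].
have [n rN] : exists n, regN r = Z.pos n.
  by case: (regN r) rpos => // n _; exists n.
have [] := @run_invariant n (table r) _ _ _ _ [::] rN erefl run.
  by exists [::].
rewrite revK cats0 => _ [cs scs ->] ->; exists (MkInstance n cs); split=> //.
exists (table_assignment n (table r)); split=> // z.
exact: Z.mod_pos_bound.
Qed.

(** * Accepting runs from satisfying assignments *)

#[local] Arguments Z.testbit : simpl never.
#[local] Arguments Z.of_nat : simpl never.

Definition value_bits (z : Z) : seq bool :=
  if z is Z.pos p then name_bits p else [::].

Lemma wsum_testbit w z : (0 <= z < 2 ^ Z.of_nat w)%Z ->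
  wsum (fun i => Z.b2z (Z.testbit z (Z.of_nat i))) (iota 0 w) = z.
Proof.
elim: w z => [|w IH] z zw; first by rewrite /=; lia.
have zE := Z.div2_odd z; rewrite -Z.bit0_odd in zE.
have -> : iota 0 w.+1 = 0 :: map S (iota 0 w) by rewrite -(iotaDl 1 0 w).
rewrite [in RHS]zE Z.add_comm /=; congr (_ + 2 * _)%Z.
rewrite Nat2Z.inj_succ Z.pow_succ_r in zw; last by lia.
rewrite -[RHS]IH; last by case: (Z.testbit z 0) zE => /=; lia.
rewrite /wsum foldr_map; elim: (iota 0 w) => //= i s ->.
by rewrite Nat2Z.inj_succ -Z.add_1_r Z.div2_spec Z.shiftr_spec //; lia.
Qed.

Section Rows.

Variables (n : positive) (a : var -> Z) (t : seq tsym) (used : var -> Prop).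
Hypothesis a_range : forall x, (0 <= a x < Z.pos n)%Z.
Hypothesis n_lt : (Z.pos n < 2 ^ Z.of_nat (size t))%Z.
Hypothesis used_occurs : forall p, used p ->
  exists pre post, t = pre ++ entry_key p ++ post.
Hypothesis used_value : forall p pre post, used p ->
  t = pre ++ entry_key p ++ post ->
  prefix (rcons (map bit (value_bits (a p))) entry_start) post.

(** The list [m] may be shorter than the row: missing marks are false, so [[::]] stands for no
    marks. *)
Definition mkrow (k v y : Z) (m : seq bool) : seq cell :=
  [seq ((Z.testbit (Z.pos n) (Z.of_nat i), Z.testbit k (Z.of_nat i)),
        (Z.testbit v (Z.of_nat i), Z.testbit y (Z.of_nat i)),
        (nth entry_start t i, nth false m i)) | i <- iota 0 (size t)].

Lemma size_mkrow k v y m : size (mkrow k v y m) = size t.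
Proof. by rewrite size_map size_iota. Qed.

Lemma mkrow_table k v y m : table (mkrow k v y m) = t.
Proof.
rewrite /table -map_comp -[RHS](mkseq_nth entry_start).
exact: eq_map.
Qed.

Lemma mkrow_marks k v y m : size m = size t -> marks (mkrow k v y m) = m.
Proof.
move=> mt; rewrite /marks -map_comp -[RHS](mkseq_nth false) /mkseq mt.
exact: eq_map.
Qed.

(** The value [Z.pos n] is allowed because [regK] reaches it when the modulus has been read. *)
Definition small (z : Z) : Prop := (0 <= z <= Z.pos n)%Z.

Lemma wsum_mkrow (f : cell -> Z) z k v y m : small z ->
  (forall i, f ((Z.testbit (Z.pos n) (Z.of_nat i), Z.testbit k (Z.of_nat i)),
        (Z.testbit v (Z.of_nat i), Z.testbit y (Z.of_nat i)),
        (nth entry_start t i, nth false m i))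
     = Z.b2z (Z.testbit z (Z.of_nat i))) ->
  wsum f (mkrow k v y m) = z.
Proof.
move=> sz fE; rewrite -[RHS](wsum_testbit (w := size t)); last first.
  by move: sz; rewrite /small; lia.
by rewrite /wsum foldr_map; elim: (iota 0 _) => //= i s ->; rewrite fE.
Qed.

Lemma mkrow_regN k v y m : regN (mkrow k v y m) = Z.pos n.
Proof. by apply: wsum_mkrow => //; rewrite /small; lia. Qed.

Lemma mkrow_regK k v y m : small k -> regK (mkrow k v y m) = k.
Proof. by move=> sk; exact: wsum_mkrow. Qed.

Lemma mkrow_regV k v y m : small v -> regV (mkrow k v y m) = v.
Proof. by move=> sv; exact: wsum_mkrow. Qed.

Lemma mkrow_regY k v y m : small y -> regY (mkrow k v y m) = y.
Proof. by move=> sy; exact: wsum_mkrow. Qed.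

Let run := row_run (Accept, None) next rule.

Lemma run_step b g s k v y m k' v' y' m' T :
  (transition (g, b)).2 (mkrow k v y m) (mkrow k' v' y' m') ->
  run (next (g, b)) s (mkrow k' v' y' m') T ->
  run g (pop b s) (mkrow k v y m) T.+1.
Proof.
move=> tr; apply: RunStep; rewrite ?size_mkrow //; split=> //.
by rewrite /static !mkrow_table !mkrow_regN.
Qed.

Lemma small_mod z : small (z mod Z.pos n).
Proof. by rewrite /small; have := Z.mod_pos_bound z (Z.pos n); lia. Qed.

Lemma small_a x : small (a x).
Proof. by rewrite /small; have := a_range x; lia. Qed.

Lemma mkrow_reduces u k v y m : (0 <= u < 2 * Z.pos n)%Z ->
  reduces (mkrow k v y m) u (u mod Z.pos n)%Z.
Proof.
move=> un; rewrite /reduces mkrow_regN.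
have := Z.mod_pos_bound u (Z.pos n); have := Z.div_mod u (Z.pos n).
move: (u mod _)%Z (u / _)%Z => r q; split; first lia.
have [q0|q1] : (q = 0 \/ q = 1)%Z by nia.
- by left; subst q; lia.
- by right; subst q; lia.
Qed.

Lemma keeps_mkrow k v y m v' m' : small k -> small y ->
  keeps (mkrow k v y m) (mkrow k v' y m').
Proof. by move=> sk sy; rewrite /keeps !mkrow_regK ?mkrow_regY. Qed.

Lemma adds_digit_mkrow b p q v y m v' m' : small y ->
  Z.pos q = (2 * p + Z.b2z b)%Z ->
  adds_digit b (mkrow (p mod Z.pos n) v y m)
    (mkrow (Z.pos q mod Z.pos n) v' y m').
Proof.
move=> sy qE; split; last by rewrite !mkrow_regY.
rewrite !mkrow_regK; try exact: small_mod.
have -> : (Z.pos q mod Z.pos n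
   = (2 * (p mod Z.pos n) + Z.b2z b) mod Z.pos n)%Z.
  by rewrite qE Z.add_mod // -Z.mul_mod_idemp_r // -Z.add_mod.
by apply: mkrow_reduces; have := Z.mod_pos_bound p (Z.pos n);
  case: b {qE} => /=; lia.
Qed.

(** Runs are built from their end. The outermost bit of [p] is the least significant one and is read
    last, so each case of the induction supplies the last Horner step. *)
Lemma run_number_bits c p s y T : small y ->
  run (NumBits, c) s (mkrow (Z.pos p mod Z.pos n) 0 y [::]) T ->
  run (NumStart, c) (rev (encode_pos p) ++ s) (mkrow 0 0 y [::])
    (T + size (encode_pos p)).
Proof.
move=> sy; elim: p s T => [p IH|p IH|] s T R.
- rewrite rev_cons cat_rcons addnS -addSn; apply: IH.
  apply: (run_step (b := Some Bit1)); last exact: R.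
  exact: adds_digit_mkrow.
- rewrite rev_cons cat_rcons addnS -addSn; apply: IH.
  apply: (run_step (b := Some Bit0)); last exact: R.
  exact: adds_digit_mkrow.
- rewrite addn1; apply: (run_step (b := Some Bit1)); last exact: R.
  (* The leading bit is a Horner step from 0, written as [0 mod Z.pos n]. *)
  by rewrite -[X in mkrow X](Z.mod_0_l (Z.pos n)) //; exact: adds_digit_mkrow.
Qed.

Lemma run_number c k s y T : small y ->
  run (VarStart, c) s (mkrow (k mod Z.pos n) 0 y [::]) T ->
  run (NumStart, c) (rev (encode_Z k) ++ s) (mkrow 0 0 y [::])
    (T + size (encode_Z k)).
Proof.
move=> sy; case: k => [|p|p] R.
- rewrite addn1; apply: (run_step (b := Some Plus)); last exact: R.
  exact: keeps_mkrow.
- rewrite rev_cons cat_rcons addnS -addSn; apply: run_number_bits => //.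
  apply: (run_step (b := Some Plus)); last exact: R.
  by apply: keeps_mkrow => //; exact: small_mod.
- rewrite rev_cons cat_rcons addnS -addSn; apply: run_number_bits => //.
  apply: (run_step (b := Some Minus)); last exact: R.
  split; first by rewrite !mkrow_regY.
  rewrite !mkrow_regK ?mkrow_regN; try exact: small_mod.
  have pn := Z.mod_pos_bound (Z.pos p) (Z.pos n) (Pos2Z.is_pos n).
  have -> : Z.neg p = (- Z.pos p)%Z by [].
  case: (Z.eq_dec (Z.pos p mod Z.pos n) 0) => p0.
    by rewrite Z.mod_opp_l_z //; move: p0 pn; clear; lia.
  by rewrite Z.mod_opp_l_nz //; move: p0 pn; clear; lia.
Qed.

Lemma matches_split s i : nth false (matches t s) i ->
  i < size t /\ exists pre, t = pre ++ s ++ drop i t.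
Proof.
case: (ltnP i (size t)) => it; last first.
  by rewrite nth_default // size_matches.
rewrite nth_matches // => /suffixP [pre E]; split=> //; exists pre.
by rewrite catA -E cat_take_drop.
Qed.

Lemma extends_match_mkrow x s k v y k' v' y' :
  extends_match x (mkrow k v y (matches t s))
    (mkrow k' v' y' (matches t (rcons s x))).
Proof.
rewrite /extends_match mkrow_marks ?size_matches //; symmetry.
by apply: matches_extend; rewrite ?mkrow_table ?mkrow_marks ?size_matches.
Qed.

Lemma forces_match_mkrow x k v y m :
  (forall i, nth false m i -> nth entry_start t i = x) ->
  forces_match x (mkrow k v y m).
Proof.
move=> mx; rewrite /forces_match all_map; apply/allP => i _ /=.
by apply/implyP => mi; apply/eqP; exact: mx.
Qed.

Lemma run_name_bits c p s k y T : small k -> small y ->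
  run (NameBits, c) s
    (mkrow k 0 y (matches t (entry_start :: map bit (name_bits p)))) T ->
  run (NameStart, c) (rev (encode_pos p) ++ s)
    (mkrow k 0 y (matches t [:: entry_start])) (T + size (encode_pos p)).
Proof.
move=> sk sy; elim: p s T => [p IH|p IH|] s T R.
- rewrite rev_cons cat_rcons addnS -addSn; apply: IH.
  apply: (run_step (b := Some Bit1)); last exact: R.
  split; first exact: keeps_mkrow.
  by rewrite [name_bits _]/= map_rcons; exact: extends_match_mkrow.
- rewrite rev_cons cat_rcons addnS -addSn; apply: IH.
  apply: (run_step (b := Some Bit0)); last exact: R.
  split; first exact: keeps_mkrow.
  by rewrite [name_bits _]/= map_rcons; exact: extends_match_mkrow.
- rewrite addn1; apply: (run_step (b := Some Bit1)); last exact: R.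
  split; first exact: keeps_mkrow.
  exact: (extends_match_mkrow _ [:: entry_start]).
Qed.

Lemma run_name c p s k y T : used p -> small k -> small y ->
  run (Value, c) s (mkrow k 0 y (matches t (entry_key p))) T ->
  run (VarStart, c) (rev (encode_var p) ++ s) (mkrow k 0 y [::])
    (T + size (encode_var p)).+1.
Proof.
move=> up sk sy R.
apply: (run_step (b := None)
  (m' := matches t [:: entry_start]) (v' := 0) (k' := k) (y' := y)).
  split; first exact: keeps_mkrow.
  rewrite /starts_match mkrow_marks ?size_matches //.
  by rewrite matches_start mkrow_table.
rewrite rev_cons cat_rcons addnS -addSn; apply: run_name_bits => //.
apply: (run_step (b := Some SVar)); last exact: R.
split; first exact: keeps_mkrow.
split; first exact: (extends_match_mkrow entry_colon (_ :: _)).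
split; last by rewrite mkrow_regV.
have [pre [post E]] := used_occurs up.
(* The mark sits on the cell after the occurrence, so the occurrence must not end the table. *)
have post0 : post != [::].
  by have := used_value up E; case: (post) => //; rewrite prefixs0; case: map.
rewrite -[has _ _](has_map cell_mark id) -/(marks _).
rewrite mkrow_marks ?size_matches //; apply/hasP; exists true => //.
have it : size (pre ++ entry_key p) < size t.
  by rewrite E catA [X in _ < X]size_cat -ltn_psubLR ?subnn lt0n size_eq0.
suff <- : nth false (matches t (entry_key p)) (size (pre ++ entry_key p))
    = true.
  by apply: mem_nth; rewrite size_matches.
rewrite nth_matches // {1}E catA take_size_cat //.
exact: suffix_suffix.
Qed.

(** All occurrences of [s0] are marked, so each of them must continue with [b] and with a further
    cell to carry the next mark. *)
Lemma run_value_step c b s0 s k v y T :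
  small k -> small y -> (0 <= v)%Z -> small (2 * v + Z.b2z b) ->
  (forall pre post, t = pre ++ s0 ++ post ->
     exists2 post', post = bit b :: post' & post' != [::]) ->
  run (Value, c) s
    (mkrow k (2 * v + Z.b2z b) y (matches t (rcons s0 (bit b)))) T ->
  run (Value, c) s (mkrow k v y (matches t s0)) T.+1.
Proof.
move=> sk sy v0 sv H R.
have sv' : small v.
  by move: sv; rewrite /small; case: b {H R} => /=; lia.
have next_b i : nth false (matches t s0) i ->
    i.+1 < size t /\ nth entry_start t i = bit b.
  case/matches_split => it [pre /H [post' E post0]].
  rewrite -[in nth _ t](cat_take_drop i t) E nth_cat size_takel ?(ltnW it) //.
  rewrite ltnn subnn /=; split=> //.
  have := congr1 size E; rewrite size_drop /=.
  by case: (post') post0 => //= x l _; lia.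
apply: (run_step (b := None)); last exact: R.
split; first exact: keeps_mkrow.
suff vb : reads_value_bit b (mkrow k v y (matches t s0))
    (mkrow k (2 * v + Z.b2z b) y (matches t (rcons s0 (bit b)))).
  by case: b {sv H R next_b} vb => vb; [right|left].
split; last by split; [exact: extends_match_mkrow | rewrite !mkrow_regV].
split; last by apply: forces_match_mkrow => i /next_b [].
rewrite mkrow_marks ?size_matches // -nth_last.
apply/negP => /next_b [] + _; rewrite size_matches.
by case: (size t) => //= w; rewrite ltnn.
Qed.

Lemma run_value_bits c q s0 s k y T : small k -> small y ->
  small (Z.pos q) ->
  (forall pre post, t = pre ++ s0 ++ post -> exists2 post',
     post = map bit (name_bits q) ++ post' & post' != [::]) ->
  run (Value, c) s
    (mkrow k (Z.pos q) y (matches t (s0 ++ map bit (name_bits q)))) T ->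
  run (Value, c) s (mkrow k 0 y (matches t s0)) (T + size (name_bits q)).
Proof.
(* The least significant bit [b] comes last in the table; the induction on [q] peels it off, leaving
   the bits of [q1] and then a single step for [b]. *)
have last_bit b q1 : (forall pre post, t = pre ++ s0 ++ post ->
      exists2 post', post = map bit (rcons (name_bits q1) b) ++ post' &
      post' != [::]) ->
    (forall pre post, t = pre ++ s0 ++ post -> exists2 post',
      post = map bit (name_bits q1) ++ post' & post' != [::]) /\
    (forall pre post, t = pre ++ (s0 ++ map bit (name_bits q1)) ++ post ->
      exists2 post', post = bit b :: post' & post' != [::]).
  move=> H; split=> pre post.
    move=> /H [post' -> _]; exists (bit b :: post') => //.
    by rewrite map_rcons cat_rcons.
  rewrite -catA => /H [post' E post0]; exists post' => //.
  by move/eqP: E; rewrite map_rcons cat_rcons eqseq_cat // eqxx => /eqP.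
move=> sk sy; elim: q T => [q IH|q IH|] T sq.
- move=> /(last_bit true) [H1 H2] R.
  have sq1 : small (Z.pos q) by move: sq; rewrite /small; lia.
  rewrite size_rcons addnS -addSn; apply: IH => //.
  apply: (run_value_step (b := true) _ _ _ _ H2) => //.
  by rewrite rcons_cat -map_rcons.
- move=> /(last_bit false) [H1 H2] R.
  have sq1 : small (Z.pos q) by move: sq; rewrite /small; lia.
  rewrite size_rcons addnS -addSn; apply: IH => //.
  apply: (run_value_step (b := false) _ _ _ _ H2) => //.
  by rewrite rcons_cat -map_rcons.
- move=> H R; rewrite addn1.
  apply: (run_value_step (b := true) _ _ _ _ H) => //.
  by rewrite -cats1.
Qed.

Lemma used_value_cat p pre post : used p ->
  t = pre ++ entry_key p ++ post -> exists2 post',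
    post = map bit (value_bits (a p)) ++ post' &
    exists s, post' = entry_start :: s.
Proof.
move=> up /(used_value up) /prefixP [s ->].
by exists (entry_start :: s); [rewrite cat_rcons | exists s].
Qed.

Lemma run_value c p s k y T : used p -> small k -> small y ->
  run (Value, c) s (mkrow k (a p) y
    (matches t (entry_key p ++ map bit (value_bits (a p))))) T ->
  run (Value, c) s (mkrow k 0 y (matches t (entry_key p)))
    (T + size (value_bits (a p))).
Proof.
move=> up sk sy; have := small_a p; have := @used_value_cat p _ _ up.
case: (a p) => [|q|q] H sa; last by move: sa; rewrite /small; lia.
- by rewrite addn0 cats0.
- by apply: run_value_bits => // pre post /H [post' -> [s' ->]];
    exists (entry_start :: s').
Qed.

Lemma ends_value_mkrow p k y : used p -> (0 <= k < Z.pos n)%Z -> small y ->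
  ends_value (mkrow k (a p) y
    (matches t (entry_key p ++ map bit (value_bits (a p)))))
    ((a p + k) mod Z.pos n)%Z.
Proof.
move=> up kn sy; have ap := a_range p.
split; last first.
  rewrite mkrow_regV ?mkrow_regK ?mkrow_regN; try by rewrite /small; lia.
  by split; [lia | apply: mkrow_reduces; lia].
apply: forces_match_mkrow => i /matches_split [it [pre]].
rewrite -catA => /(used_value_cat up) [post' /eqP].
rewrite eqseq_cat // eqxx => /eqP D [s' E].
rewrite -[in nth _ t](cat_take_drop i t) D E nth_cat size_takel ?(ltnW it) //.
by rewrite ltnn subnn.
Qed.

Lemma run_var c p s k y T : used p -> small k -> small y ->
  run (Value, c) s (mkrow k (a p) y
    (matches t (entry_key p ++ map bit (value_bits (a p))))) T ->
  run (VarStart, c) (rev (encode_var p) ++ s) (mkrow k 0 y [::])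
    (T + size (value_bits (a p)) + size (encode_var p)).+1.
Proof. by move=> up sk sy /run_value R; apply: run_name => //; exact: R. Qed.

(** At a boundary [regK] holds a leftover of the constraint just read, hence the quantifier over
    [k]. *)
Definition bound_run (s : seq symbol) (T : nat) : Prop :=
  forall k, small k -> run (Bound, None) s (mkrow k 0 0 [::]) T.

Variable w : nat.
Hypothesis value_size : forall p, size (value_bits (a p)) <= w.

Lemma run_left_term rel p s k y T : used p -> (0 <= k < Z.pos n)%Z ->
  small y -> compares rel ((a p + k) mod Z.pos n)%Z y -> bound_run s T ->
  run (VarStart, Some rel) (rev (encode_var p) ++ Sep :: s) (mkrow k 0 y [::])
    (T + w + size (encode_var p) + 2).
Proof.
move=> up kn sy cmp R; have sk : small k by rewrite /small; lia.
apply: (@row_run_le _ _ _ _ _ _ _ _ _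
  (T.+1 + size (value_bits (a p)) + size (encode_var p)).+1).
  by have := value_size p; lia.
apply: run_var => //.
apply: (run_step (b := Some Sep)); last first.
  by apply: (R ((a p + k) mod Z.pos n)%Z); exact: small_mod.
rewrite /= mkrow_regK ?mkrow_regY //; last exact: small_mod.
by split=> //; exact: ends_value_mkrow.
Qed.

Lemma bound_run_cst rel x k s T : used x ->
  rel \in [:: SLe; SGe; SLt; SGt; SEq] ->
  compares rel (residue n (a x)) (residue n k) -> bound_run s T ->
  bound_run (rev (Sep :: encode_var x ++ rel :: encode_Z k) ++ s)
    (T + size (Sep :: encode_var x ++ rel :: encode_Z k) + w + 2).
Proof.
move=> ux relP cmp R k0 sk0.
rewrite -cat_cons rev_cat -catA 2!rev_cons 2!cat_rcons.
apply: (@row_run_le _ _ _ _ _ _ _ _ _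
  ((T + w + size (encode_var x) + 2).+1 + size (encode_Z k)).+1).
  by rewrite /= size_cat /=; lia.
apply: (run_step (b := None) (k' := 0%Z) (v' := 0%Z) (y' := 0%Z) (m' := [::])).
  by rewrite /= mkrow_regK.
rewrite -[next _]/(NumStart, @None symbol); apply: run_number => //.
have E : next ((VarStart, None), Some rel) = (VarStart, Some rel).
  by rewrite /next /= relP.
apply: (run_step (b := Some rel) (k' := 0%Z) (v' := 0%Z)
  (y' := (k mod Z.pos n)%Z) (m' := [::])).
  rewrite /= relP /= mkrow_regY ?mkrow_regK //; exact: small_mod.
rewrite E; apply: run_left_term => //; first exact: small_mod.
by rewrite Z.add_0_r.
Qed.

(** Besides the symbols read, there are at most [w] steps for the bits of each value and 3 steps
    without input: one at the boundary and one before each name. *)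
Lemma bound_run_var rel x k y l s T : used x -> used y ->
  rel \in [:: SLe; SLt; SEq] ->
  compares rel (residue n (a x + k)) (residue n (a y + l)) -> bound_run s T ->
  let c := encode_var x ++ encode_Z k ++ rel :: encode_var y ++ encode_Z l in
  bound_run (rev (Sep :: c) ++ s) (T + size (Sep :: c) + 2 * w + 3).
Proof.
move=> ux uy relP cmp R c k0 sk0.
rewrite /c -2!cat_cons !rev_cat -!catA 2!rev_cons 2!cat_rcons.
apply: (@row_run_le _ _ _ _ _ _ _ _ _
  ((((T + w + size (encode_var x) + 2) + size (encode_Z k)).+1
    + size (value_bits (a y)) + size (encode_var y)).+1
    + size (encode_Z l)).+1).
  have := value_size y; rewrite /c /= !size_cat /= !size_cat /=; lia.
apply: (run_step (b := None) (k' := 0%Z) (v' := 0%Z) (y' := 0%Z) (m' := [::])).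
  by rewrite /= mkrow_regK.
rewrite -[next _]/(NumStart, @None symbol).
apply: run_number => //; apply: run_var => //; first exact: small_mod.
have E : next ((Value, None), Some rel) = (NumStart, Some rel).
  by rewrite /next /= relP.
apply: (run_step (b := Some rel) (k' := 0%Z) (v' := 0%Z)
  (y' := ((a y + l) mod Z.pos n)%Z) (m' := [::])).
  rewrite /= relP /= mkrow_regY ?mkrow_regK //; last exact: small_mod.
  split=> //; rewrite -(Z.add_mod_idemp_r _ l) //.
  by apply: ends_value_mkrow => //; exact: Z.mod_pos_bound.
rewrite E; apply: run_number; first exact: small_mod.
apply: run_left_term => //; [exact: Z.mod_pos_bound | exact: small_mod |].
by rewrite Z.add_mod_idemp_r.
Qed.

Definition constraint_vars (c : constraint) : seq var :=
  match c with
  | VarLeVar x _ y _ | VarLtVar x _ y _ | VarEqVar x _ y _ => [:: x; y]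
  | VarLeCst x _ | VarGeCst x _ | VarLtCst x _ | VarGtCst x _
  | VarEqCst x _ => [:: x]
  end.

Lemma bound_run_constraint c s T : List.Forall used (constraint_vars c) ->
  satisfies n a c -> bound_run s T ->
  bound_run (rev (Sep :: encode_constraint c) ++ s)
    (T + size (Sep :: encode_constraint c) + 2 * w + 3).
Proof.
have le_cst m k : m + k + w + 2 <= m + k + 2 * w + 3 by lia.
have weaken s' T1 T2 : T1 <= T2 -> bound_run s' T1 -> bound_run s' T2.
  by move=> le12 R k sk; exact: row_run_le le12 (R k sk).
case: c => [x k y l|x k|x k|x k y l|x k|x k|x k y l|x k]
  /List.Forall_cons_iff [ux].
- by move=> /List.Forall_cons_iff [uy _] sat R; apply: bound_run_var.
- by move=> _ sat R; apply: weaken (bound_run_cst (rel := SLe) _ _ _ R).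
- move=> _ sat R; apply: weaken (bound_run_cst (rel := SGe) _ _ _ R) => //.
  exact: Z.ge_le.
- by move=> /List.Forall_cons_iff [uy _] sat R; apply: bound_run_var.
- by move=> _ sat R; apply: weaken (bound_run_cst (rel := SLt) _ _ _ R).
- move=> _ sat R; apply: weaken (bound_run_cst (rel := SGt) _ _ _ R) => //.
  exact: Z.gt_lt.
- by move=> /List.Forall_cons_iff [uy _] sat R; apply: bound_run_var.
- by move=> _ sat R; apply: weaken (bound_run_cst (rel := SEq) _ _ _ R).
Qed.

Lemma bound_run_constraints cs s T :
  List.Forall used (flatten (map constraint_vars cs)) ->
  List.Forall (satisfies n a) cs -> bound_run s T ->
  let e := flatten [seq Sep :: encode_constraint c | c <- cs] in
  bound_run (rev e ++ s) (T + size e * (2 * w + 4)).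
Proof.
elim: cs s T => [|c cs IH] s T /=; first by rewrite addn0.
move=> /List.Forall_app [uc ucs] /List.Forall_cons_iff [sc scs] R.
rewrite -cat_cons rev_cat -catA => k sk.
apply: row_run_le (IH _ _ ucs scs (bound_run_constraint uc sc R) k sk).
(* The separator makes each encoded constraint nonempty, so its [2 * w + 3] extra steps are covered
   by the factor [2 * w + 4]. *)
by rewrite size_cat /=; nia.
Qed.

(** The leading parts of [p] are at most [n], so they fit in [regK] unreduced. *)
Lemma run_modulus p s T : small (Z.pos p) ->
  run (ModBits, None) s (mkrow (Z.pos p) 0 0 [::]) T ->
  forall k, small k ->
  run (Bound, None) (rev (encode_pos p) ++ s) (mkrow k 0 0 [::])
    (T + size (encode_pos p)).
Proof.
elim: p s T => [p IH|p IH|] s T sp R k sk.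
- have sp1 : small (Z.pos p) by move: sp; rewrite /small; lia.
  rewrite rev_cons cat_rcons addnS -addSn; apply: IH => //.
  by apply: (run_step (b := Some Bit1)); last exact: R; rewrite /= !mkrow_regK.
- have sp1 : small (Z.pos p) by move: sp; rewrite /small; lia.
  rewrite rev_cons cat_rcons addnS -addSn; apply: IH => //.
  by apply: (run_step (b := Some Bit0)); last exact: R; rewrite /= !mkrow_regK.
- rewrite addn1; apply: (run_step (b := Some Bit1)); last exact: R.
  by rewrite /= mkrow_regK.
Qed.

Lemma bound_run_modulus :
  bound_run (rev (encode_pos n)) (size (encode_pos n)).+1.
Proof.
have sn : small (Z.pos n) by rewrite /small; lia.
rewrite -[rev _]cats0 -add1n; apply: run_modulus => //.
apply: (run_step (b := None) (k' := 0%Z) (v' := 0%Z) (y' := 0%Z) (m' := [::])).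
  by rewrite /= mkrow_regK ?mkrow_regN.
exact: RunAccept.
Qed.

End Rows.

(** * The table of a satisfying assignment *)

Lemma size_name_bits p : size (name_bits p) = size (encode_pos p).
Proof. by elim: p => //= p IH; rewrite size_rcons IH. Qed.

Lemma name_bits_inj : injective name_bits.
Proof.
have encE p : encode_pos p =
    [seq if b : bool then Bit1 else Bit0 | b <- rev (name_bits p)].
  by elim: p => //= p ->; rewrite rev_rcons.
move=> p q pq; have E : encode_pos p ++ [::] = encode_pos q ++ [::].
  by rewrite !encE pq.
by have [] := encode_pos_cat_inj _ _ E.
Qed.

Lemma pos_lt_pow2 p : (Z.pos p < 2 ^ Z.of_nat (size (encode_pos p)))%Z.
Proof.
elim: p => [p IH|p IH|] //.
- by rewrite [size _]/= Nat2Z.inj_succ Z.pow_succ_r; lia.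
- by rewrite [size _]/= Nat2Z.inj_succ Z.pow_succ_r; lia.
Qed.

Lemma size_value_bits z n : (0 <= z < Z.pos n)%Z ->
  size (value_bits z) <= size (encode_pos n).
Proof.
have sizeE p : Pos.size_nat p = size (encode_pos p).
  by elim: p => //= p ->.
case: z => //= p [_ pn]; rewrite size_name_bits -!sizeE.
by apply/leP; apply: Pos.size_nat_monotone.
Qed.

Section Table.

Variable a : var -> Z.

Definition entry (p : var) : seq tsym :=
  entry_key p ++ map bit (value_bits (a p)).

(** The padding ends the value of the last entry and makes the row long enough for the registers. *)
Definition table_of (vs : seq var) (k : nat) : seq tsym :=
  flatten (map entry vs) ++ nseq k.+1 entry_start.

Lemma bits_colon_inj u v s s' :
  map bit u ++ entry_colon :: s = map bit v ++ entry_colon :: s' ->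
  u = v /\ s = s'.
Proof.
by elim: u v => [|b u IH] [|c v] //= [] // -> /IH [-> ->].
Qed.

Lemma skip_no_start u s pre post : entry_start \notin u ->
  u ++ s = pre ++ entry_start :: post ->
  exists pre', s = pre' ++ entry_start :: post.
Proof.
elim: u pre => [|x u IH] pre /=; first by exists pre.
rewrite inE negb_or => /andP [xs us].
case: pre => [|y pre] [E1 E2]; last exact: IH us E2.
by rewrite E1 eqxx in xs.
Qed.

Lemma table_of_head vs k : exists s, table_of vs k = entry_start :: s.
Proof.
case: vs => [|p vs]; first by exists (nseq k entry_start).
by eexists; rewrite /table_of /=.
Qed.

(** The symbol [entry_start] occurs only at the head of an entry and in the padding, which has no
    colon. So each occurrence of the key heads an entry, which by injectivity of [name_bits] is one
    of [p]; repeated entries carry the same value. *)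
Lemma table_of_value vs k p pre post :
  table_of vs k = pre ++ entry_key p ++ post ->
  prefix (rcons (map bit (value_bits (a p))) entry_start) post.
Proof.
have no_start u : entry_start \notin map bit u by elim: u.
elim: vs pre => [|q vs IH] pre.
  move=> E; have : entry_colon \in table_of [::] k.
    by rewrite E /entry_key !(mem_cat, inE, mem_rcons) eqxx !orbT.
  by rewrite /table_of /= inE mem_nseq andbF.
rewrite /table_of /= -catA -/(table_of vs k).
case: pre => [|x pre] [].
  rewrite -!cats1 -!catA /= => /bits_colon_inj [/name_bits_inj -> <-].
  have [s ->] := table_of_head vs k.
  by rewrite -[_ :: s]cat1s catA prefix_prefix.
move=> _.
case/skip_no_start => [|pre' E]; last exact: IH E.
by rewrite mem_cat mem_rcons inE negb_or !no_start.
Qed.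

Lemma table_of_occurs vs k p : List.In p vs ->
  exists pre post, table_of vs k = pre ++ entry_key p ++ post.
Proof.
move=> pvs; have [vs1 [vs2 ->]] := List.in_split p vs pvs.
exists (flatten (map entry vs1)), (map bit (value_bits (a p)) ++
  flatten (map entry vs2) ++ nseq k.+1 entry_start).
by rewrite /table_of map_cat flatten_cat -!catA.
Qed.

End Table.

Lemma instance_complete x : problem_language encode_instance satisfiable x ->
  exists r m, [/\ row_run (Accept, None) next rule (Bound, None) (rev x) r m,
    size r <= 10 * (size x).+1 ^ 2 & m <= 10 * (size x).+1 ^ 2].
Proof.
move=> [[n cs] [-> [a [/= a_range scs]]]].
pose vs := flatten (map constraint_vars cs).
pose e := flatten [seq Sep :: encode_constraint c | c <- cs].
have -> : encode_instance (MkInstance n cs) = encode_pos n ++ e by [].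
pose w := size (encode_pos n).
have vsize p := size_value_bits (a_range p).
(* An entry has at most [size (encode_var p) + 1 + w] symbols, and the variables of a constraint
   have disjoint encodings in it. *)
have te : size (flatten (map (entry a) vs)) <= size e * (w + 2).
  rewrite /vs /e; elim: cs {scs} @vs @e => //= c cs IH.
  have entry_size p : size (entry a p) <= size (encode_var p) * (w + 2).
    rewrite /entry size_cat size_map /= size_rcons size_map size_name_bits.
    have := vsize p; rewrite -/w; nia.
  rewrite map_cat flatten_cat !size_cat /= ?size_cat mulSn mulnDl.
  suff : size (flatten (map (entry a) (constraint_vars c)))
      <= size (encode_constraint c) * (w + 2) by move: IH; lia.
  have flat1 (u : seq tsym) : size (flatten [:: u]) = size u.
    by rewrite /= cats0.
  have flat2 (u v : seq tsym) : size (flatten [:: u; v]) = size u + size v.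
    by rewrite /= cats0 size_cat.
  case: c {IH} => [p k q l|p k|p k|p k q l|p k|p k|p k q l|p k];
    rewrite [map _ _]/= ?flat1 ?flat2;
    try (apply: leq_trans (leq_add (entry_size p) (entry_size q)) _;
      rewrite -mulnDl);
    try apply: leq_trans (entry_size p) _;
    rewrite leq_mul2r /= !size_cat /= ?size_cat /=; apply/orP; right; lia.
pose t := table_of a vs w.
have n_lt : (Z.pos n < 2 ^ Z.of_nat (size t))%Z.
  (* The padding alone has more than [w] cells, and [w] bits hold [n]. *)
  apply: Z.lt_le_trans (pos_lt_pow2 n) _; apply: Z.pow_le_mono_r => //.
  by rewrite /t /table_of size_cat size_nseq -/w; lia.
have uvs : List.Forall (fun p => List.In p vs) vs.
  by apply/List.Forall_forall.
have R := bound_run_constraints a_range n_lt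
  (fun p => @table_of_occurs a vs w p)
  (fun p pre post _ => @table_of_value a vs w p pre post) vsize uvs scs
  (@bound_run_modulus n t n_lt).
exists (mkrow n t 0 0 0 [::]), (w.+1 + size e * (2 * w + 4)).
split.
- by rewrite rev_cat; apply: R; rewrite /small; lia.
- rewrite size_mkrow /t /table_of !size_cat size_nseq -/w; nia.
- by rewrite size_cat -/w; nia.
Qed.

Theorem theorem3 : in_NP (problem_language encode_instance satisfiable).
Proof.
apply: (@row_system_in_NP symbol _ _ (Bound, None) (Accept, None)
  next rule _ 10 2).
- exact: rule_regular.
- exact: run_sound.
- exact: instance_complete.
Qed.
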